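(* Let $\phi\in\mathcal{A}^*$ and $\dot{k}\in\mathbb{C}$. Then the universal Whittaker $\widehat{\mathfrak{sl}_2}$-module $W(\widehat{\mathfrak{sl}_2},\phi,\dot{k})$ is simple if and only if $\phi\notin\mathcal{E}$.
   Context: All Lie algebras are over $\mathbb{C}$; $\mathbb{N}$ is the set of nonnegative integers; $\mathcal{A}=\mathbb{C}[t,t^{-1}]$. Let $\mathfrak{sl}_2$ have standard basis $\{\mathrm{e},\mathrm{h},\mathrm{f}\}$ with $[\mathrm{e},\mathrm{f}]=\mathrm{h}$, $[\mathrm{h},\mathrm{e}]=2\mathrm{e}$, $[\mathrm{h},\mathrm{f}]=-2\mathrm{f}$, and let $(\cdot,\cdot)$ be a nondegenerate invariant symmetric bilinear form on $\mathfrak{sl}_2$. The affine Lie algebra is $\widehat{\mathfrak{sl}_2}=\mathfrak{sl}_2\otimes\mathbb{C}[t,t^{-1}]\oplus\mathbb{C}\boldsymbol{k}$ with $\boldsymbol{k}$ central and $[x\otimes t^k,y\otimes t^l]=[x,y]\otimes t^{k+l}+k(x,y)\delta_{k+l,0}\boldsymbol{k}$ for $x,y\in\mathfrak{sl}_2$, $k,l\in\mathbb{Z}$. For $\phi\in\mathcal{A}^*$ and $\dot{k}\in\mathbb{C}$, $W(\widehat{\mathfrak{sl}_2},\phi,\dot{k})=\mathcal{U}(\widehat{\mathfrak{sl}_2})\otimes_{\mathcal{U}(\mathrm{e}\otimes\mathbb{C}[t,t^{-1}]\oplus\mathbb{C}\boldsymbol{k})}\mathbb{C}w_\phi$, where $\mathbb{C}w_\phi$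 is the one-dimensional $(\mathrm{e}\otimes\mathbb{C}[t,t^{-1}]\oplus\mathbb{C}\boldsymbol{k})$-module determined by $(\mathrm{e}\otimes t^k).w_\phi=\phi(t^k)w_\phi$ ($k\in\mathbb{Z}$) and $\boldsymbol{k}.w_\phi=\dot{k}w_\phi$. A linear functional $\chi\in\mathcal{A}^*$ is exp-polynomial if there is a finite sum expression $\chi(t^n)=\sum_{k\in\mathbb{N}}\sum_{\lambda\in\mathbb{C}^\times}c_{k,\lambda}n^k\lambda^n$ (finitely many nonzero $c_{k,\lambda}\in\mathbb{C}$, with $0^0=1$) valid for all $n\in\mathbb{Z}$; $\mathcal{E}\subseteq\mathcal{A}^*$ is the subspace of all exp-polynomial functionals. *)

(* Defs.v *)
From HB Require Import structures.
From mathcomp Require Import all_boot all_order all_algebra.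
From mathcomp Require Import finmap ring.
From mathcomp Require Import boolp reals.
From mathcomp.real_closed Require Import complex.
From mathcomp.multinomials Require Import monalg.

Set Implicit Arguments.
Unset Strict Implicit.
Unset Printing Implicit Defensive.

Import Order.TTheory GRing.Theory Num.Theory.
Local Open Scope ring_scope.
Local Open Scope quotient_scope.

(* Additive extension of F to finitely supported functions
   (F k is meant to be additive for every k). *)
Definition msum (K : choiceType) (G V : zmodType) (F : K -> G -> V)
  (a : {malg G[K]}) : V := \sum_(k <- msupp a) F k a@_k.

Section MsumTheory.
Variables (K : choiceType) (G V : zmodType) (F : K -> G -> V).
Hypothesis FB : forall k, {morph F k : x y / x - y}.

Let F0 k : F k 0 = 0. Proof. by rewrite -[0 in LHS](subrr 0) FB subrr. Qed.

Lemma msumEw (d : {fset K}) (a : {malg G[K]}) : (msupp a `<=` d)%fset ->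
  msum F a = \sum_(k <- d) F k a@_k.
Proof.
by move=> le; rewrite [LHS](big_fset_incl _ le) => //= x _ /mcoeff_outdom ->.
Qed.

Lemma msumU k x : msum F << x *g k >> = F k x.
Proof. by rewrite (msumEw msuppU_le) big_seq_fset1 mcoeffUU. Qed.

Lemma msumB : {morph msum F : a b / a - b}.
Proof.
move=> a b; pose d := (msupp a `|` msupp b)%fset.
rewrite (msumEw (msuppB_le a b)) (@msumEw d a) ?fsubsetUl //.
rewrite (@msumEw d b) ?fsubsetUr // -sumrB.
by apply: eq_bigr => k _; rewrite mcoeffB FB.
Qed.

Lemma msum0 : msum F 0 = 0. Proof. by rewrite /msum msupp0 big_seq_fset0. Qed.

Lemma msumN : {morph msum F : a / - a}.
Proof. by move=> a; rewrite -[in LHS](sub0r a) msumB msum0 sub0r. Qed.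

Lemma msumD : {morph msum F : a b / a + b}.
Proof. by move=> a b; rewrite -[in LHS](opprK b) msumB msumN opprK. Qed.

End MsumTheory.

Lemma msum_subF (K : choiceType) (G V : zmodType) (F F' : K -> G -> V) a :
  msum (fun k x => F k x - F' k x) a = msum F a - msum F' a.
Proof. by rewrite /msum sumrB. Qed.

Lemma malg_ind (K : choiceType) (G : zmodType) (P : {malg G[K]} -> Prop) :
  P 0 -> (forall a b, P a -> P b -> P (a + b)) ->
  (forall k x, P << x *g k >>) -> forall a, P a.
Proof.
by move=> P0 PD PU a; rewrite [a]monalgE; apply: big_ind.
Qed.

HB.mixin Record Lmodule_isLieAlgebra (k : comNzRingType) L
    of GRing.Lmodule k L := {
  lie : L -> L -> L;
  lie_linear_l : forall y, linear (lie^~ y);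
  lie_linear_r : forall x, linear (lie x);
  liexx : forall x, lie x x = 0;
  lie_jacobi : forall x y z,
    lie x (lie y z) + lie y (lie z x) + lie z (lie x y) = 0
}.

#[short(type="lieAlgType")]
HB.structure Definition LieAlgebra (k : comNzRingType) :=
  { L of GRing.Lmodule k L & Lmodule_isLieAlgebra k L }.

Section LieTheory.
Variables (k : comNzRingType) (g : lieAlgType k).
Implicit Types x y z : g.

Lemma lieBl y : {morph (@lie k g)^~ y : x z / x - z}.
Proof.
by move=> x z; rewrite addrC -scaleN1r lie_linear_l scaleN1r addrC.
Qed.
Lemma lieBr x : {morph lie x : y z / y - z}.
Proof.
by move=> y z; rewrite addrC -scaleN1r lie_linear_r scaleN1r addrC.
Qed.
Lemma lie0l y : lie 0 y = 0 :> g.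
Proof. by rewrite -[0 in LHS](subrr 0) lieBl subrr. Qed.
Lemma lie0r x : lie x 0 = 0.
Proof. by rewrite -[0 in LHS](subrr 0) lieBr subrr. Qed.
Lemma lieDl y : {morph (@lie k g)^~ y : x z / x + z}.
Proof. by move=> x z; rewrite -[x in LHS]scale1r lie_linear_l scale1r. Qed.
Lemma lieDr x : {morph lie x : y z / y + z}.
Proof. by move=> y z; rewrite -[y in LHS]scale1r lie_linear_r scale1r. Qed.
Lemma lieZl c x y : lie (c *: x) y = c *: lie x y.
Proof. by rewrite -[c *: x]addr0 lie_linear_l lie0l addr0. Qed.
Lemma lieZr c x y : lie x (c *: y) = c *: lie x y.
Proof. by rewrite -[c *: y]addr0 lie_linear_r lie0r addr0. Qed.
Lemma lieC x y : lie x y = - lie y x.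
Proof.
apply/eqP; rewrite -addr_eq0; apply/eqP.
by have := liexx (x + y); rewrite lieDl !lieDr !liexx add0r addr0.
Qed.
Lemma lieNr x y : lie x (- y) = - lie x y.
Proof. by rewrite -scaleN1r lieZr scaleN1r. Qed.
End LieTheory.

Record lie_hom (k : comNzRingType) (g h : lieAlgType k) := LieHom {
  lie_hom_fun :> g -> h;
  lie_hom_linear : linear lie_hom_fun;
  lie_hom_lie : forall x y,
    lie_hom_fun (lie x y) = lie (lie_hom_fun x) (lie_hom_fun y)
}.

Definition two_sided_ideal (A : nzRingType) (I : A -> Prop) : Prop :=
  [/\ I 0, forall x y, I x -> I y -> I (x - y),
      forall a x, I x -> I (a * x) & forall a x, I x -> I (x * a)].

Definition ideal_gen (A : nzRingType) (S : A -> Prop) : {pred A} :=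
  fun x => `[< forall I : A -> Prop, two_sided_ideal I ->
               (forall s, S s -> I s) -> I x >].

Section IdealGen.
Variables (A : nzRingType) (S : A -> Prop).

Lemma ideal_gen_ideal : two_sided_ideal (fun x => x \in ideal_gen S).
Proof.
split.
- by apply/asboolP => I [].
- move=> x y /asboolP xI /asboolP yI; apply/asboolP => I idI SI.
  by have [_ + _ _] := idI; apply; [apply: xI | apply: yI].
- move=> a x /asboolP xI; apply/asboolP => I idI SI.
  by have [_ _ + _] := idI; apply; apply: xI.
- move=> a x /asboolP xI; apply/asboolP => I idI SI.
  by have [_ _ _ +] := idI; apply; apply: xI.
Qed.

Lemma mem_ideal_gen s : S s -> s \in ideal_gen S.
Proof. by move=> Ss; apply/asboolP => I _; apply. Qed.

Lemma ideal_gen_min (I : A -> Prop) : two_sided_ideal I ->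
  (forall s, S s -> I s) -> forall x, x \in ideal_gen S -> I x.
Proof. by move=> idI SI x /asboolP; apply. Qed.

Lemma ideal_gen_zmod : zmod_closed (ideal_gen S).
Proof.
have [I0 IB _ _] := ideal_gen_ideal; split; first exact: I0.
by move=> x y; apply: IB.
Qed.
End IdealGen.

HB.instance Definition _ (A : nzRingType) (S : A -> Prop) :=
  GRing.isZmodClosed.Build A (ideal_gen S) (ideal_gen_zmod S).

Section UEA.
Variables (k : comNzRingType) (g : lieAlgType k).

Definition free_alg := {malg k[{fmonom g}]}.
HB.instance Definition _ := GRing.Lalgebra.on free_alg.
Definition free_gen (x : g) : free_alg := << fmu x >>.

(* The first two families of relations cut the free algebra on the set g down
   to the tensor algebra of the vector space g. *)
Inductive uea_rel : free_alg -> Prop :=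
| UeaAdd x y : uea_rel (free_gen (x + y) - (free_gen x + free_gen y))
| UeaScale c x : uea_rel (free_gen (c *: x) - c *: free_gen x)
| UeaLie x y : uea_rel
    (free_gen (lie x y) - (free_gen x * free_gen y - free_gen y * free_gen x)).

Definition uea_ideal : {pred free_alg} := ideal_gen uea_rel.
HB.instance Definition _ := GRing.ZmodClosed.on uea_ideal.

Lemma mem_uea_ideal a : uea_rel a -> a \in uea_ideal.
Proof. exact: mem_ideal_gen. Qed.

Definition uea := Quotient.quot uea_ideal.
HB.instance Definition _ := GRing.Zmodule.on uea.

Definition uea_pi (a : free_alg) : uea := \pi_uea a.

Lemma uea_piB : {morph uea_pi : a b / a - b}.
Proof. by move=> a b; rewrite /uea_pi !piE. Qed.

Lemma uea_piD : {morph uea_pi : a b / a + b}.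
Proof. by move=> a b; rewrite /uea_pi !piE. Qed.

Lemma uea_pi0 : uea_pi 0 = 0.
Proof. by rewrite -[0 in LHS](subrr 0) uea_piB subrr. Qed.

Lemma uea_piP a b : (uea_pi a = uea_pi b) <-> (a - b \in uea_ideal).
Proof. by rewrite Quotient.idealrBE; split => /eqP. Qed.

Lemma uea_piK (u : uea) : uea_pi (repr u) = u.
Proof. exact: reprK. Qed.

Lemma repr_uea_pi a : repr (uea_pi a) - a \in uea_ideal.
Proof. by apply/uea_piP; rewrite uea_piK. Qed.

Lemma uea_ind (P : uea -> Prop) : (forall a, P (uea_pi a)) -> forall u, P u.
Proof. by move=> PP u; rewrite -(uea_piK u). Qed.

Definition uea_one : uea := uea_pi 1.
Definition uea_mul : uea -> uea -> uea := lift_op2 uea *%R.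
Definition uea_scale (c : k) : uea -> uea := lift_op1 uea (GRing.scale c).

Lemma uea_mulE a b : uea_mul (uea_pi a) (uea_pi b) = uea_pi (a * b).
Proof.
unlock uea_mul; apply/uea_piP; have [_ _ IL IR] := ideal_gen_ideal uea_rel.
set a' := repr (uea_pi a); set b' := repr (uea_pi b).
have -> : a' * b' - a * b = a' * (b' - b) + (a' - a) * b.
  by rewrite mulrBr mulrBl addrA subrK.
by rewrite rpredD //; [apply: IL | apply: IR]; apply: repr_uea_pi.
Qed.

Lemma uea_scaleE c a : uea_scale c (uea_pi a) = uea_pi (c *: a).
Proof.
unlock uea_scale; apply/uea_piP; have [_ _ IL _] := ideal_gen_ideal uea_rel.
by rewrite -scalerBr -mul_malgC; apply/IL/repr_uea_pi.
Qed.

Lemma uea_mulA : associative uea_mul.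
Proof.
by do 3!elim/uea_ind => ?; rewrite !uea_mulE mulrA.
Qed.
Lemma uea_mul1 : left_id uea_one uea_mul.
Proof. by elim/uea_ind => ?; rewrite uea_mulE mul1r. Qed.
Lemma uea_mulr1 : right_id uea_one uea_mul.
Proof. by elim/uea_ind => ?; rewrite uea_mulE mulr1. Qed.
Lemma uea_mulDl : left_distributive uea_mul +%R.
Proof.
by do 3!elim/uea_ind => ?; rewrite -uea_piD !uea_mulE -uea_piD mulrDl.
Qed.
Lemma uea_mulDr : right_distributive uea_mul +%R.
Proof.
by do 3!elim/uea_ind => ?; rewrite -uea_piD !uea_mulE -uea_piD mulrDr.
Qed.

Lemma uea_one_neq0 : uea_one != 0.
Proof.
apply/eqP; rewrite -uea_pi0 => /uea_piP; rewrite subr0.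
pose I (a : free_alg) := a@_(mone : {fmonom g}) = 0.
have idI : two_sided_ideal I.
  split=> [|x y|a x|a x]; rewrite /I ?mcoeff0 ?mcoeffB ?rmorphM //=.
  - by move=> -> ->; rewrite subr0.
  - by move=> ->; rewrite mulr0.
  - by move=> ->; rewrite mul0r.
have gen0 x : (free_gen x)@_(mone : {fmonom g}) = 0.
  by rewrite mcoeffU -fdeg_eq0 fdegU.
have [_ IB IL _] := idI.
have ID a b : I a -> I b -> I (a + b).
  by rewrite /I mcoeffD => -> ->; rewrite addr0.
move/(ideal_gen_min idI) => H; have {H} : I 1.
  apply: H => s [x y|c x|x y]; apply: (IB _ _ (gen0 _)).
  - exact: ID.
  - by rewrite /I mcoeffZ gen0 mulr0.
  - by apply: IB; apply: IL.
by rewrite /I rmorph1 => /eqP; rewrite oner_eq0.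
Qed.

HB.instance Definition _ := GRing.Zmodule_isNzRing.Build uea
  uea_mulA uea_mul1 uea_mulr1 uea_mulDl uea_mulDr uea_one_neq0.

Lemma uea_scaleA a b u : uea_scale a (uea_scale b u) = uea_scale (a * b) u.
Proof. by elim/uea_ind: u => ?; rewrite !uea_scaleE scalerA. Qed.
Lemma uea_scale1 : left_id 1 uea_scale.
Proof. by elim/uea_ind => ?; rewrite !uea_scaleE scale1r. Qed.
Lemma uea_scaleDr : right_distributive uea_scale +%R.
Proof.
move=> c; do 2!elim/uea_ind => ?.
by rewrite -uea_piD !uea_scaleE -uea_piD scalerDr.
Qed.
Lemma uea_scaleDl u : {morph uea_scale^~ u : a b / a + b}.
Proof.
by elim/uea_ind: u => ? a b; rewrite !uea_scaleE -uea_piD scalerDl.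
Qed.

HB.instance Definition _ := GRing.Zmodule_isLmodule.Build k uea
  uea_scaleA uea_scale1 uea_scaleDr uea_scaleDl.

Lemma uea_scaleAl (c : k) (u v : uea) : c *: (u * v) = c *: u * v.
Proof.
elim/uea_ind: u => a; elim/uea_ind: v => b.
by rewrite /GRing.scale /GRing.mul /= !(uea_mulE, uea_scaleE) scalerAl.
Qed.
HB.instance Definition _ := GRing.Lmodule_isLalgebra.Build k uea uea_scaleAl.

Lemma uea_piM : {morph uea_pi : a b / a * b}.
Proof. by move=> a b; rewrite -uea_mulE. Qed.
Lemma uea_piZ c : {morph uea_pi : a / c *: a}.
Proof. by move=> a; rewrite -uea_scaleE. Qed.
Lemma uea_pi1 : uea_pi 1 = 1. Proof. by []. Qed.

Lemma free_scaleAr (c : k) (a b : free_alg) : c *: (a * b) = a * (c *: b).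
Proof.
suff cA : c%:MP * a = a * c%:MP.
  rewrite -!mul_malgC; apply: etrans (mulrA c%:MP a b) _.
  apply: etrans (esym (mulrA a c%:MP b)).
  exact: (congr1 (fun d : free_alg => d * b) cA).
elim/malg_ind: a => [|a a' IH IH'|m x].
- by rewrite mul0r mulr0.
- by rewrite mulrDl mulrDr IH IH'.
by rewrite !malgM_def !fgmulUU mul1m mulm1 mulrC.
Qed.

Lemma uea_scaleAr (c : k) (u v : uea) : c *: (u * v) = u * (c *: v).
Proof.
elim/uea_ind: u => a; elim/uea_ind: v => b.
by rewrite -uea_piM -!uea_piZ -uea_piM free_scaleAr.
Qed.
HB.instance Definition _ := GRing.Lalgebra_isAlgebra.Build k uea uea_scaleAr.

Definition uea_gen (x : g) : uea := uea_pi (free_gen x).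

Lemma uea_gen_linear : linear uea_gen.
Proof.
move=> c x y; rewrite /uea_gen -uea_piZ -uea_piD.
transitivity (uea_pi (free_gen (c *: x) + free_gen y)).
  by apply/uea_piP/mem_uea_ideal/UeaAdd.
rewrite !uea_piD; congr (_ + _).
by apply/uea_piP/mem_uea_ideal/UeaScale.
Qed.

Lemma uea_gen_lie x y :
  uea_gen (lie x y) = uea_gen x * uea_gen y - uea_gen y * uea_gen x.
Proof.
by rewrite /uea_gen -!uea_piM -uea_piB; apply/uea_piP/mem_uea_ideal/UeaLie.
Qed.

End UEA.
Arguments uea_ideal {k} g _.

Record lie_rep (k : comNzRingType) (g : lieAlgType k) (A : algType k) := LieRep {
  lie_rep_fun :> g -> A;
  lie_rep_linear : linear lie_rep_fun;
  lie_rep_lie : forall x y, lie_rep_fun (lie x y) =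
    lie_rep_fun x * lie_rep_fun y - lie_rep_fun y * lie_rep_fun x
}.

Section UEALift.
Variables (k : comNzRingType) (g : lieAlgType k) (A : algType k).
Variable (f : lie_rep g A).

Definition word_eval (m : {fmonom g}) : A := \prod_(x <- m) f x.

Lemma word_eval_morph : mmorphism word_eval.
Proof.
split=> [m n|]; last by rewrite /word_eval fm1 big_nil.
by rewrite /word_eval fmM big_cat.
Qed.
HB.instance Definition _ :=
  isMultiplicative.Build {fmonom g} A word_eval word_eval_morph.

Definition free_eval : free_alg g -> A := mmap (in_alg A) word_eval.

Lemma free_evalM : monoid_morphism free_eval.
Proof.
have [M one] : multiplicative free_eval.
  apply: commr_mmap_is_multiplicative => a m m'.
  by rewrite /GRing.comm /= mulr_algl mulr_algr.
by split.
Qed.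

Lemma free_evalB : {morph free_eval : a b / a - b}.
Proof. exact: mmapB. Qed.
Lemma free_evalD : {morph free_eval : a b / a + b}.
Proof. exact: mmapD. Qed.

Lemma free_evalZ c a : free_eval (c *: a) = c *: free_eval a.
Proof. by rewrite /free_eval mmapZ /= mulr_algl. Qed.

Lemma free_eval_gen x : free_eval (free_gen x) = f x.
Proof.
by rewrite /free_eval mmapU /word_eval fmU big_seq1 /= scale1r mul1r.
Qed.

Lemma free_eval_ideal a : a \in uea_ideal g -> free_eval a = 0.
Proof.
have [F1 FM] := free_evalM; move: a.
apply: (ideal_gen_min (I := fun a => free_eval a = 0)) => [|s].
  split=> [|x y|b x|b x]; first exact: mmap0.
  - by rewrite free_evalB => -> ->; rewrite subr0.
  - by rewrite FM => ->; rewrite mulr0.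
  - by rewrite FM => ->; rewrite mul0r.
case=> [x y|c x|x y].
- rewrite free_evalB free_evalD !free_eval_gen.
  by have := lie_rep_linear f 1 x y; rewrite !scale1r => ->; rewrite subrr.
- rewrite free_evalB free_evalZ !free_eval_gen.
  have f0 : f 0 = 0.
    by rewrite -[0 in LHS](subrr 0) addrC -scaleN1r lie_rep_linear scaleN1r addNr.
  have := lie_rep_linear f c x 0; rewrite !addr0 => ->.
  by rewrite f0 addr0 subrr.
- have FMg u v : free_eval (free_gen u * free_gen v) = f u * f v.
    by apply: etrans (FM _ _) _; congr (_ * _); apply: free_eval_gen.
  apply: etrans (free_evalB _ _) _; apply/eqP; rewrite subr_eq0; apply/eqP.
  apply: etrans (free_eval_gen _) _; apply: etrans (lie_rep_lie _ _ _) _.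
  by apply/esym/(etrans (free_evalB _ _)); congr (_ - _); apply: FMg.
Qed.

Definition uea_lift : uea g -> A := lift_fun1 (uea g) free_eval.

Lemma uea_liftE a : uea_lift (uea_pi a) = free_eval a.
Proof.
unlock uea_lift; apply/eqP; rewrite -subr_eq0 -free_evalB; apply/eqP/free_eval_ideal.
exact: repr_uea_pi.
Qed.

Lemma uea_lift_gen x : uea_lift (uea_gen x) = f x.
Proof. by rewrite uea_liftE free_eval_gen. Qed.

Lemma uea_lift_zmod : zmod_morphism uea_lift.
Proof.
by do 2!elim/uea_ind => ?; rewrite -uea_piB !uea_liftE free_evalB.
Qed.
Lemma uea_lift_monoid : monoid_morphism uea_lift.
Proof.
split; first by rewrite -uea_pi1 uea_liftE; exact: free_evalM.1.
by do 2!elim/uea_ind => ?; rewrite -uea_piM !uea_liftE free_evalM.2.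
Qed.
HB.instance Definition _ :=
  GRing.isZmodMorphism.Build (uea g) A uea_lift uea_lift_zmod.
HB.instance Definition _ :=
  GRing.isMonoidMorphism.Build (uea g) A uea_lift uea_lift_monoid.

Lemma uea_lift_scalable : scalable uea_lift.
Proof.
by move=> c; elim/uea_ind => ?; rewrite -uea_piZ !uea_liftE free_evalZ.
Qed.
HB.instance Definition _ :=
  GRing.isScalable.Build k (uea g) A *:%R uea_lift uea_lift_scalable.
End UEALift.

Section UEAMap.
Variables (k : comNzRingType) (g h : lieAlgType k) (f : lie_hom g h).

Let uea_map_linear : linear (fun x => uea_gen (f x)).
Proof. by move=> c x y; rewrite lie_hom_linear uea_gen_linear. Qed.
Let uea_map_lie x y : uea_gen (f (lie x y)) =
  uea_gen (f x) * uea_gen (f y) - uea_gen (f y) * uea_gen (f x).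
Proof. by rewrite lie_hom_lie uea_gen_lie. Qed.

Definition uea_map_rep : lie_rep g (uea h) := LieRep uea_map_linear uea_map_lie.
Definition uea_map : uea g -> uea h := uea_lift uea_map_rep.
HB.instance Definition _ := GRing.LRMorphism.on uea_map.

Lemma uea_map_gen x : uea_map (uea_gen x) = uea_gen (f x).
Proof. exact: uea_lift_gen. Qed.
End UEAMap.


Definition subgroup_pred (V : zmodType) (H : V -> Prop) : Prop :=
  H 0 /\ forall x y, H x -> H y -> H (x - y).

Definition subgroup_gen (V : zmodType) (S : V -> Prop) : {pred V} :=
  fun x => `[< forall H : V -> Prop, subgroup_pred H ->
               (forall s, S s -> H s) -> H x >].

Section SubgroupGen.
Variables (V : zmodType) (S : V -> Prop).

Lemma subgroup_gen_zmod : zmod_closed (subgroup_gen S).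
Proof.
split=> [|x y /asboolP xH /asboolP yH]; first by apply/asboolP => H [].
apply/asboolP => H sgH SH; have [_] := sgH.
by apply; [apply: xH | apply: yH].
Qed.

Lemma mem_subgroup_gen s : S s -> s \in subgroup_gen S.
Proof. by move=> Ss; apply/asboolP => H _; apply. Qed.

Lemma subgroup_gen_min (H : V -> Prop) : subgroup_pred H ->
  (forall s, S s -> H s) -> forall x, x \in subgroup_gen S -> H x.
Proof. by move=> sgH SH x /asboolP; apply. Qed.
End SubgroupGen.

HB.instance Definition _ (V : zmodType) (S : V -> Prop) :=
  GRing.isZmodClosed.Build V (subgroup_gen S) (subgroup_gen_zmod S).

Section ExtScalars.
Variables (S R : nzRingType) (f : {rmorphism S -> R}) (M : lmodType S).

Definition free_tens := {malg int[(R * M)%type]}.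
Definition ftens (r : R) (m : M) : free_tens := << (r, m) >>.

Inductive tens_rel : free_tens -> Prop :=
| TensAddl r r' m : tens_rel (ftens (r + r') m - (ftens r m + ftens r' m))
| TensAddr r m m' : tens_rel (ftens r (m + m') - (ftens r m + ftens r m'))
| TensBal r s m : tens_rel (ftens (r * f s) m - ftens r (s *: m)).

Definition tens_sub : {pred free_tens} := subgroup_gen tens_rel.
HB.instance Definition _ := GRing.ZmodClosed.on tens_sub.

(* The tensor product over S of R, a right S-module via f, with M. *)
Definition ext_scalars := Quotient.quot tens_sub.
HB.instance Definition _ := GRing.Zmodule.on ext_scalars.

Definition tens_pi (a : free_tens) : ext_scalars := \pi_ext_scalars a.
Definition tens (r : R) (m : M) : ext_scalars := tens_pi (ftens r m).

Lemma tens_piB : {morph tens_pi : a b / a - b}.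
Proof. by move=> a b; rewrite /tens_pi !piE. Qed.
Lemma tens_piD : {morph tens_pi : a b / a + b}.
Proof. by move=> a b; rewrite /tens_pi !piE. Qed.
Lemma tens_pi0 : tens_pi 0 = 0.
Proof. by rewrite -[0 in LHS](subrr 0) tens_piB subrr. Qed.
Lemma tens_piP a b : (tens_pi a = tens_pi b) <-> (a - b \in tens_sub).
Proof. by rewrite Quotient.idealrBE; split => /eqP. Qed.
Lemma tens_piK (u : ext_scalars) : tens_pi (repr u) = u.
Proof. exact: reprK. Qed.
Lemma repr_tens_pi a : repr (tens_pi a) - a \in tens_sub.
Proof. by apply/tens_piP; rewrite tens_piK. Qed.
Lemma mem_tens_sub a : tens_rel a -> a \in tens_sub.
Proof. exact: mem_subgroup_gen. Qed.

Lemma tens_addl r r' m : tens (r + r') m = tens r m + tens r' m.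
Proof. by rewrite -tens_piD; apply/tens_piP/mem_tens_sub/TensAddl. Qed.
Lemma tens_addr r m m' : tens r (m + m') = tens r m + tens r m'.
Proof. by rewrite -tens_piD; apply/tens_piP/mem_tens_sub/TensAddr. Qed.
Lemma tens_bal r s m : tens (r * f s) m = tens r (s *: m).
Proof. exact/tens_piP/mem_tens_sub/TensBal. Qed.

Lemma tens_ind (P : ext_scalars -> Prop) :
  P 0 -> (forall u v, P u -> P v -> P (u - v)) ->
  (forall r m, P (tens r m)) -> forall u, P u.
Proof.
move=> P0 PB PT u; rewrite -(tens_piK u).
have PN v : P v -> P (- v) by move=> Pv; rewrite -sub0r; apply: PB.
have PD v w : P v -> P w -> P (v + w).
  by move=> Pv Pw; rewrite -[w]opprK; apply: PB => //; apply: PN.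
have Pn v n : P v -> P (v *+ n).
  by move=> Pv; elim: n => [|n IH]; rewrite ?mulr0n // mulrS; apply: PD.
elim/malg_ind: (repr u) => [|a b Pa Pb|[r m] n]; first by rewrite tens_pi0.
  by rewrite tens_piD; apply: PD.
have piMn (a : free_tens) j : tens_pi (a *+ j) = tens_pi a *+ j.
  by elim: j => [|j IH]; rewrite ?mulr0n ?tens_pi0 // !mulrS tens_piD IH.
case: n => n.
  rewrite -[Posz n]natz monalgUMn piMn; apply: Pn; exact: PT.
rewrite NegzE -[Posz n.+1]natz monalgUN -[- _]sub0r tens_piB tens_pi0.
by apply: PB => //; rewrite monalgUMn piMn; apply/Pn/PT.
Qed.

Definition ftens_act (r : R) : free_tens -> free_tens :=
  msum (fun (p : R * M) (n : int) => << n *g (r * p.1, p.2) >>).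

Lemma ftens_act_add (r : R) (p : R * M) :
  {morph (fun n : int => << n *g (r * p.1, p.2) >> : free_tens) : x y / x - y}.
Proof. by move=> x y; rewrite monalgUB. Qed.

Lemma ftens_actB r : {morph ftens_act r : a b / a - b}.
Proof. by apply: msumB; apply: ftens_act_add. Qed.
Lemma ftens_actD r : {morph ftens_act r : a b / a + b}.
Proof. by apply: msumD; apply: ftens_act_add. Qed.
Lemma ftens_actE r r' m : ftens_act r (ftens r' m) = ftens (r * r') m.
Proof. by rewrite /ftens_act msumU //; apply: ftens_act_add. Qed.

Lemma ftens_act_sub r a : a \in tens_sub -> ftens_act r a \in tens_sub.
Proof.
move: a.
apply: (subgroup_gen_min (H := fun a => ftens_act r a \in tens_sub)) => [|s].
  split=> [|x y xH yH]; first by rewrite /ftens_act msum0 rpred0.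
  by rewrite ftens_actB rpredB.
case=> [r1 r2 m|r1 m m'|r1 s' m]; rewrite ftens_actB ?ftens_actD !ftens_actE.
- by rewrite mulrDr; apply/mem_tens_sub/TensAddl.
- exact/mem_tens_sub/TensAddr.
- by rewrite mulrA; apply/mem_tens_sub/TensBal.
Qed.

Definition tens_act (r : R) : ext_scalars -> ext_scalars :=
  lift_op1 ext_scalars (ftens_act r).

Lemma tens_act_pi r a : tens_act r (tens_pi a) = tens_pi (ftens_act r a).
Proof.
unlock tens_act; apply/tens_piP.
by rewrite -ftens_actB ftens_act_sub ?repr_tens_pi.
Qed.

Lemma tens_actE r r' m : tens_act r (tens r' m) = tens (r * r') m.
Proof. by rewrite tens_act_pi ftens_actE. Qed.

Lemma tens_actB r : {morph tens_act r : u v / u - v}.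
Proof.
move=> u v; rewrite -(tens_piK u) -(tens_piK v).
by rewrite -tens_piB !tens_act_pi ftens_actB tens_piB.
Qed.
Lemma tens_act0 r : tens_act r 0 = 0.
Proof. by rewrite -[0 in LHS](subrr 0) tens_actB subrr. Qed.

Lemma tens_actA a b u : tens_act a (tens_act b u) = tens_act (a * b) u.
Proof.
elim/tens_ind: u => [|u v IHu IHv|r m]; first by rewrite !tens_act0.
  by rewrite !tens_actB IHu IHv.
by rewrite !tens_actE mulrA.
Qed.
Lemma tens_act1 : left_id 1 tens_act.
Proof.
elim/tens_ind => [|u v IHu IHv|r m]; first by rewrite !tens_act0.
  by rewrite !tens_actB IHu IHv.
by rewrite !tens_actE mul1r.
Qed.
Lemma tens_actDr : right_distributive tens_act +%R.
Proof.
move=> r u v; rewrite -[v]opprK tens_actB -[- - v]sub0r tens_actB tens_act0.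
by rewrite sub0r.
Qed.
Lemma tens_actDl u : {morph tens_act^~ u : a b / a + b}.
Proof.
elim/tens_ind: u => [|u v IHu IHv|r m] a b; first by rewrite !tens_act0 addr0.
  by rewrite !tens_actB IHu IHv opprD addrACA.
by rewrite !tens_actE mulrDl tens_addl.
Qed.

HB.instance Definition _ := GRing.Zmodule_isLmodule.Build R ext_scalars
  tens_actA tens_act1 tens_actDr tens_actDl.

Lemma scale_tens r r' m : r *: tens r' m = tens (r * r') m.
Proof. exact: tens_actE. Qed.

End ExtScalars.
Arguments tens_sub {S R} f M _.

(* Boolean predicates range over all subsets: see asbool in boolp. *)
Definition simple_module (R : nzRingType) (M : lmodType R) : Prop :=
  (exists m : M, m != 0) /\
  forall N : {pred M}, submod_closed N ->
    (forall m, m \in N -> m = 0) \/ (forall m, m \in N).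

(* Laurent polynomials with coefficients in V, as finitely supported functions
   from the integers to V: << v *g n >> stands for the tensor of v and t^n. *)

Section Laurent.
Variables (k : nzRingType) (V : lmodType k).

Definition laurent := {malg V[int]}.
HB.instance Definition _ := GRing.Zmodule.on laurent.

Definition laurent_scale (c : k) (a : laurent) : laurent :=
  [malg n in msupp a => c *: a@_n].

Lemma laurent_scaleE c a n : (laurent_scale c a)@_n = c *: a@_n.
Proof. by rewrite mcoeffE; case: msuppP => //; rewrite scaler0. Qed.

Lemma laurent_scaleA c d a :
  laurent_scale c (laurent_scale d a) = laurent_scale (c * d) a.
Proof. by apply/malgP => n; rewrite !laurent_scaleE scalerA. Qed.
Lemma laurent_scale1 : left_id 1 laurent_scale.
Proof. by move=> a; apply/malgP => n; rewrite laurent_scaleE scale1r. Qed.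
Lemma laurent_scaleDr : right_distributive laurent_scale +%R.
Proof.
move=> c a b; apply/malgP => n.
by rewrite mcoeffD !laurent_scaleE mcoeffD scalerDr.
Qed.
Lemma laurent_scaleDl a : {morph laurent_scale^~ a : c d / c + d}.
Proof.
by move=> c d; apply/malgP => n; rewrite mcoeffD !laurent_scaleE scalerDl.
Qed.
HB.instance Definition _ := GRing.Zmodule_isLmodule.Build k laurent
  laurent_scaleA laurent_scale1 laurent_scaleDr laurent_scaleDl.

Definition tmon (v : V) (n : int) : laurent := << v *g n >>.

Lemma laurent_coefZ c (a : laurent) n : (c *: a)@_n = c *: a@_n.
Proof. exact: laurent_scaleE. Qed.
Lemma tmonZ c v n : c *: tmon v n = tmon (c *: v) n.
Proof.
by apply/malgP => m; rewrite laurent_coefZ !mcoeffU scalerMnr.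
Qed.
Lemma tmonB n : {morph tmon^~ n : v w / v - w}.
Proof. by move=> v w; rewrite /tmon monalgUB. Qed.
Lemma tmonD n : {morph tmon^~ n : v w / v + w}.
Proof. by move=> v w; rewrite /tmon monalgUD. Qed.
Lemma tmon0 n : tmon 0 n = 0. Proof. exact: monalgU0. Qed.
End Laurent.

Record inv_form (k : comNzRingType) (g : lieAlgType k) := InvForm {
  inv_form_fun :> g -> g -> k;
  inv_form_linear : forall y, scalar (inv_form_fun^~ y);
  inv_form_sym : forall x y, inv_form_fun x y = inv_form_fun y x;
  inv_form_lie : forall x y z,
    inv_form_fun (lie x y) z = inv_form_fun x (lie y z)
}.

Definition nondegenerate_form (k : comNzRingType) (g : lieAlgType k)
  (B : inv_form g) : Prop := forall x, (forall y, B x y = 0) -> x = 0.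

Lemma morphB_D (V W : zmodType) (f : V -> W) :
  {morph f : x y / x - y} -> {morph f : x y / x + y}.
Proof.
move=> fB x y; have f0 : f 0 = 0 by rewrite -[0 in LHS](subrr 0) fB subrr.
by rewrite -[y in LHS]opprK fB -[- y]sub0r fB f0 sub0r opprK.
Qed.

Section InvFormTheory.
Variables (k : comNzRingType) (g : lieAlgType k) (B : inv_form g).

Lemma formBl y : {morph B^~ y : x z / x - z}.
Proof.
move=> x z; have /= := inv_form_linear B y (-1) z x.
by rewrite scaleN1r mulN1r [- z + x]addrC [- B z y + _]addrC.
Qed.
Lemma form0l y : B 0 y = 0.
Proof. by rewrite -[0 in LHS](subrr 0) formBl subrr. Qed.
Lemma formZl c x y : B (c *: x) y = c * B x y.
Proof.
by have := inv_form_linear B y c x 0; rewrite addr0 form0l addr0.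
Qed.
Lemma formBr x : {morph B x : y z / y - z}.
Proof. by move=> y z; rewrite inv_form_sym formBl !(inv_form_sym _ x). Qed.
Lemma form0r x : B x 0 = 0.
Proof. by rewrite inv_form_sym form0l. Qed.
Lemma formZr c x y : B x (c *: y) = c * B x y.
Proof. by rewrite inv_form_sym formZl inv_form_sym. Qed.
End InvFormTheory.

(* The pair (a, r) stands for a + r K, where K is the central element.
   B is a phantom argument of the type: only the bracket depends on it. *)
Definition affine (k : comNzRingType) (g : lieAlgType k) (B : inv_form g)
  : Type :=
  (laurent g * k^o)%type.

Section Affine.
Variables (k : comNzRingType) (g : lieAlgType k) (B : inv_form g).
Implicit Types (a b c : laurent g).

Definition loop_lie a b : laurent g :=
  msum (fun m x => msum (fun n y => tmon (lie x y) (m + n)) b) a.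

Definition loop_cocycle a b : k :=
  msum (fun m x => msum
    (fun n y => if m + n == 0 then m%:~R * B x y else 0) b) a.

Let lie_tB x m n : {morph (fun y : g => tmon (lie x y) (m + n)) : y z / y - z}.
Proof. by move=> y z; rewrite lieBr tmonB. Qed.

Let coc_tB x (m n : int) :
  {morph (fun y => if m + n == 0 then m%:~R * B x y else 0) : y z / y - z}.
Proof. by move=> y z; case: eqP; rewrite ?subrr // formBr mulrBr. Qed.

Let lie_tBl b m :
  {morph (fun x => msum (fun n y => tmon (lie x y) (m + n)) b) : x z / x - z}.
Proof.
move=> x z; rewrite -msum_subF; apply: eq_bigr => n _.
by rewrite lieBl tmonB.
Qed.

Let coc_tBl b (m : int) :
  {morph (fun x => msum
    (fun (n : int) y => if m + n == 0 then m%:~R * B x y else 0) b)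
    : x z / x - z}.
Proof.
move=> x z; rewrite -msum_subF; apply: eq_bigr => n _.
by case: eqP; rewrite ?subrr // formBl mulrBr.
Qed.

Lemma loop_lieBl b : {morph loop_lie^~ b : a c / a - c}.
Proof. exact: msumB. Qed.
Lemma loop_lieBr a : {morph loop_lie a : b c / b - c}.
Proof.
move=> b c; rewrite -msum_subF; apply: eq_bigr => m _.
by rewrite msumB.
Qed.
Lemma cocycleBl b : {morph loop_cocycle^~ b : a c / a - c}.
Proof. exact: msumB. Qed.
Lemma cocycleBr a : {morph loop_cocycle a : b c / b - c}.
Proof.
move=> b c; rewrite -msum_subF; apply: eq_bigr => m _.
by rewrite msumB.
Qed.

Lemma loop_lie_tmon x m y n :
  loop_lie (tmon x m) (tmon y n) = tmon (lie x y) (m + n).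
Proof. by rewrite /loop_lie !msumU. Qed.

Lemma cocycle_tmon x m y n : loop_cocycle (tmon x m) (tmon y n) =
  if m + n == 0 then m%:~R * B x y else 0.
Proof. by rewrite /loop_cocycle !msumU. Qed.

Lemma loop_lie0l b : loop_lie 0 b = 0. Proof. exact: msum0. Qed.
Lemma loop_lie0r a : loop_lie a 0 = 0.
Proof. by rewrite -[X in loop_lie _ X](subrr 0) loop_lieBr subrr. Qed.
Lemma cocycle0l b : loop_cocycle 0 b = 0. Proof. exact: msum0. Qed.
Lemma cocycle0r a : loop_cocycle a 0 = 0.
Proof. by rewrite -[X in loop_cocycle _ X](subrr 0) cocycleBr subrr. Qed.
Lemma loop_lieDl b : {morph loop_lie^~ b : a c / a + c}.
Proof. exact/morphB_D/loop_lieBl. Qed.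
Lemma loop_lieDr a : {morph loop_lie a : b c / b + c}.
Proof. exact/morphB_D/loop_lieBr. Qed.
Lemma cocycleDl b : {morph loop_cocycle^~ b : a c / a + c}.
Proof. exact/morphB_D/cocycleBl. Qed.
Lemma cocycleDr a : {morph loop_cocycle a : b c / b + c}.
Proof. exact/morphB_D/cocycleBr. Qed.

Lemma laurent_ind (P : laurent g -> Prop) : P 0 ->
  (forall a b, P a -> P b -> P (a + b)) -> (forall x n, P (tmon x n)) ->
  forall a, P a.
Proof. by move=> P0 PD PU; apply: malg_ind => // n x; apply: PU. Qed.

Lemma loop_lieC a b : loop_lie a b = - loop_lie b a.
Proof.
elim/laurent_ind: a => [|a a' IH IH'|x m].
- by rewrite loop_lie0l loop_lie0r oppr0.
- by rewrite loop_lieDl loop_lieDr IH IH' opprD.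
elim/laurent_ind: b => [|b b' IH IH'|y n].
- by rewrite loop_lie0l loop_lie0r oppr0.
- by rewrite loop_lieDl loop_lieDr IH IH' opprD.
by rewrite !loop_lie_tmon lieC addrC -sub0r tmonB tmon0 sub0r.
Qed.

Lemma cocycleC a b : loop_cocycle a b = - loop_cocycle b a.
Proof.
elim/laurent_ind: a => [|a a' IH IH'|x m].
- by rewrite cocycle0l cocycle0r oppr0.
- by rewrite cocycleDl cocycleDr IH IH' opprD.
elim/laurent_ind: b => [|b b' IH IH'|y n].
- by rewrite cocycle0l cocycle0r oppr0.
- by rewrite cocycleDl cocycleDr IH IH' opprD.
rewrite !cocycle_tmon (addrC n) inv_form_sym; case: eqP; rewrite ?oppr0 //.
by move=> /eqP; rewrite addr_eq0 => /eqP->; rewrite mulrNz mulNr.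
Qed.

Lemma loop_liexx a : loop_lie a a = 0.
Proof.
elim/laurent_ind: a => [|a b IHa IHb|x n]; first exact: loop_lie0l.
  by rewrite loop_lieDl !loop_lieDr IHa IHb (loop_lieC b) add0r addr0 subrr.
by rewrite loop_lie_tmon liexx tmon0.
Qed.

Lemma cocyclexx a : loop_cocycle a a = 0.
Proof.
elim/laurent_ind: a => [|a b IHa IHb|x n]; first exact: cocycle0l.
  by rewrite cocycleDl !cocycleDr IHa IHb (cocycleC b) add0r addr0 subrr.
rewrite cocycle_tmon; case: eqP => // /eqP.
by rewrite -mulr2n mulrn_eq0 /= => /eqP->; rewrite mul0r.
Qed.

Lemma loop_lieZl r a b : loop_lie (r *: a) b = r *: loop_lie a b.
Proof.
elim/laurent_ind: a => [|a a' IH IH'|x m].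
- by rewrite scaler0 loop_lie0l scaler0.
- by rewrite scalerDr !loop_lieDl scalerDr IH IH'.
elim/laurent_ind: b => [|b b' IH IH'|y n].
- by rewrite !loop_lie0r scaler0.
- by rewrite !loop_lieDr scalerDr IH IH'.
by rewrite tmonZ !loop_lie_tmon tmonZ lieZl.
Qed.

Lemma cocycleZl r a b : loop_cocycle (r *: a) b = r * loop_cocycle a b.
Proof.
elim/laurent_ind: a => [|a a' IH IH'|x m].
- by rewrite scaler0 cocycle0l mulr0.
- by rewrite scalerDr !cocycleDl mulrDr IH IH'.
elim/laurent_ind: b => [|b b' IH IH'|y n].
- by rewrite !cocycle0r mulr0.
- by rewrite !cocycleDr mulrDr IH IH'.
by rewrite tmonZ !cocycle_tmon; case: eqP; rewrite ?mulr0 // formZl mulrCA.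
Qed.

Let lin3 (V : zmodType) (T : laurent g -> laurent g -> laurent g -> V) :
  (forall b c, {morph (fun a => T a b c) : a a' / a + a'}) ->
  (forall a c, {morph (fun b => T a b c) : a a' / a + a'}) ->
  (forall a b, {morph T a b : a a' / a + a'}) ->
  (forall x m y n z p, T (tmon x m) (tmon y n) (tmon z p) = 0) ->
  forall a b c, T a b c = 0.
Proof.
move=> D1 D2 D3 T0.
have cancel0 (v : V) : v = v + v -> v = 0.
  by move=> /eqP; rewrite -subr_eq subrr eq_sym => /eqP.
move=> a b c; elim/laurent_ind: a => [|a a' IH IH'|x m].
- by apply: cancel0; rewrite -D1 addr0.
- by rewrite D1 IH IH' addr0.
elim/laurent_ind: b => [|b b' IH IH'|y n].
- by apply: cancel0; rewrite -D2 addr0.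
- by rewrite D2 IH IH' addr0.
elim/laurent_ind: c => [|c c' IH IH'|z p]; last exact: T0.
- by apply: cancel0; rewrite -D3 addr0.
- by rewrite D3 IH IH' addr0.
Qed.

Let add3ACA (V : zmodType) (a a' b b' c c' : V) :
  a + a' + (b + b') + (c + c') = a + b + c + (a' + b' + c').
Proof. by rewrite (addrACA a) (addrACA (a + b)). Qed.

Lemma loop_jacobi a b c :
  loop_lie a (loop_lie b c) + loop_lie b (loop_lie c a)
    + loop_lie c (loop_lie a b) = 0.
Proof.
pose T a b c := loop_lie a (loop_lie b c) + loop_lie b (loop_lie c a)
    + loop_lie c (loop_lie a b).
apply: (lin3 (T := T)); rewrite /T.
- by move=> u v w w'; rewrite !loop_lieDl !loop_lieDr add3ACA.
- by move=> u v w w'; rewrite !loop_lieDl !loop_lieDr add3ACA.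
- by move=> u v w w'; rewrite !loop_lieDl !loop_lieDr add3ACA.
move=> x m y n z p; rewrite !loop_lie_tmon.
rewrite (addrC p m) (addrCA n m p) [p + _]addrC -[m + n + p]addrA.
by rewrite -!tmonD lie_jacobi tmon0.
Qed.

Lemma cocycle_jacobi a b c :
  loop_cocycle a (loop_lie b c) + loop_cocycle b (loop_lie c a)
    + loop_cocycle c (loop_lie a b) = 0.
Proof.
pose T a b c := loop_cocycle a (loop_lie b c) + loop_cocycle b (loop_lie c a)
    + loop_cocycle c (loop_lie a b).
apply: (lin3 (T := T)); rewrite /T.
- by move=> u v w w'; rewrite loop_lieDr loop_lieDl cocycleDl !cocycleDr add3ACA.
- by move=> u v w w'; rewrite loop_lieDr loop_lieDl cocycleDl !cocycleDr add3ACA.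
- by move=> u v w w'; rewrite loop_lieDr loop_lieDl cocycleDl !cocycleDr add3ACA.
move=> x m y n z p; rewrite !loop_lie_tmon !cocycle_tmon.
rewrite (addrC p m) (addrCA n m p) [p + _]addrC -[m + n + p]addrA.
case: eqP => [mnp|_]; last by rewrite !addr0.
have -> : B y (lie z x) = B x (lie y z) by rewrite -inv_form_lie inv_form_sym.
have -> : B z (lie x y) = B x (lie y z) by rewrite inv_form_sym inv_form_lie.
by rewrite -!mulrDl -!intrD -addrA mnp mul0r.
Qed.

HB.instance Definition _ := GRing.Lmodule.on (affine B).

Definition affine_lie (u v : affine B) : affine B :=
  (loop_lie u.1 v.1, loop_cocycle u.1 v.1).

Lemma affine_lie_linear_l v : linear (affine_lie^~ v).
Proof.
move=> r u w; rewrite /affine_lie /=.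
by rewrite loop_lieDl loop_lieZl cocycleDl cocycleZl.
Qed.
Lemma affine_lieC u v : affine_lie u v = - affine_lie v u.
Proof. by rewrite /affine_lie loop_lieC cocycleC. Qed.
Lemma affine_lie_linear_r v : linear (affine_lie v).
Proof.
move=> r u w; rewrite affine_lieC affine_lie_linear_l.
by rewrite opprD -scalerN -!affine_lieC.
Qed.
Lemma affine_liexx u : affine_lie u u = 0.
Proof. by rewrite /affine_lie loop_liexx cocyclexx. Qed.
Lemma affine_jacobi u v w :
  affine_lie u (affine_lie v w) + affine_lie v (affine_lie w u)
    + affine_lie w (affine_lie u v) = 0.
Proof.
by congr (_, _); rewrite /= ?loop_jacobi ?cocycle_jacobi.
Qed.
HB.instance Definition _ := Lmodule_isLieAlgebra.Build k (affine B)
  affine_lie_linear_l affine_lie_linear_r affine_liexx affine_jacobi.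
End Affine.

Section SL2.
Variable k : comNzRingType.

Definition tr0 : {pred 'M[k]_2} := fun M => \tr M == 0.

Lemma tr0_submod : submod_closed tr0.
Proof.
split=> [|c M N /eqP trM /eqP trN]; rewrite unfold_in ?mxtrace0 //.
by rewrite mxtraceD mxtraceZ trM trN mulr0 addr0.
Qed.
HB.instance Definition _ := GRing.isSubmodClosed.Build k 'M[k]_2 tr0 tr0_submod.

Record sl2 := SL2 { sl2_mx :> 'M[k]_2; sl2_mxP : sl2_mx \in tr0 }.
HB.instance Definition _ := [isSub for sl2_mx].
HB.instance Definition _ := [Choice of sl2 by <:].
HB.instance Definition _ := [SubChoice_isSubLmodule of sl2 by <:].

Lemma sl2_lie_subproof (x y : sl2) :
  (x *m y - y *m x : 'M[k]_2) \in tr0.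
Proof. by rewrite unfold_in raddfB /= mxtrace_mulC subrr. Qed.
Definition sl2_lie (x y : sl2) : sl2 := SL2 (sl2_lie_subproof x y).

Lemma sl2_lie_linear_l y : linear (sl2_lie^~ y).
Proof.
move=> c x z; apply: val_inj; rewrite /= mulmxDl mulmxDr -scalemxAl -scalemxAr.
by rewrite scalerBr opprD addrACA.
Qed.
Lemma sl2_lie_linear_r x : linear (sl2_lie x).
Proof.
move=> c y z; apply: val_inj; rewrite /= mulmxDl mulmxDr -scalemxAl -scalemxAr.
by rewrite scalerBr opprD addrACA.
Qed.
Lemma sl2_liexx x : sl2_lie x x = 0.
Proof. by apply: val_inj; rewrite /= subrr. Qed.
Lemma sl2_jacobi x y z :
  sl2_lie x (sl2_lie y z) + sl2_lie y (sl2_lie z x) + sl2_lie z (sl2_lie x y)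
    = 0.
Proof.
apply: val_inj; rewrite /= !mulmxBl !mulmxBr !mulmxA !opprB.
by apply/matrixP => i j; rewrite !mxE; ring.
Qed.
HB.instance Definition _ := Lmodule_isLieAlgebra.Build k sl2
  sl2_lie_linear_l sl2_lie_linear_r sl2_liexx sl2_jacobi.

Lemma sl2_e_subproof : delta_mx 0 1 \in tr0.
Proof. by rewrite unfold_in /mxtrace !big_ord_recl big_ord0 !mxE !addr0. Qed.
Lemma sl2_f_subproof : delta_mx 1 0 \in tr0.
Proof. by rewrite unfold_in /mxtrace !big_ord_recl big_ord0 !mxE !addr0. Qed.
Lemma sl2_h_subproof : delta_mx 0 0 - delta_mx 1 1 \in tr0.
Proof.
by rewrite unfold_in /mxtrace !big_ord_recl big_ord0 !mxE /= subr0 sub0r addr0 subrr.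
Qed.
Definition sl2_e : sl2 := SL2 sl2_e_subproof.
Definition sl2_f : sl2 := SL2 sl2_f_subproof.
Definition sl2_h : sl2 := SL2 sl2_h_subproof.

Lemma lie_ef : lie sl2_e sl2_f = sl2_h.
Proof. by apply: val_inj; rewrite /= !mul_delta_mx. Qed.
Lemma lie_he : lie sl2_h sl2_e = 2 *: sl2_e.
Proof.
apply: val_inj; rewrite /= mulmxBl mulmxBr !mul_delta_mx_cond /=.
by rewrite !(mulr0n, mulr1n) subr0 sub0r opprK -mulr2n scaler_nat.
Qed.
Lemma lie_hf : lie sl2_h sl2_f = - 2 *: sl2_f.
Proof.
apply: val_inj; rewrite /= mulmxBl mulmxBr !mul_delta_mx_cond /=.
by rewrite !(mulr0n, mulr1n) subr0 sub0r -opprD -mulr2n scaleNr scaler_nat.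
Qed.
End SL2.

Arguments sl2_e {k}.
Arguments sl2_f {k}.
Arguments sl2_h {k}.

(* The pair (a, r) stands for the tensor of e and a, plus r K: this is the
   subalgebra spanned by K and the e t^n, which is abelian. It is embedded in the
   affine Lie algebra by eAK_hom below. *)
Section EAK.
Variable k : numFieldType.

Definition eAK := (laurent k^o * k^o)%type.
HB.instance Definition _ := GRing.Lmodule.on eAK.

Definition eAK_lie (u v : eAK) : eAK := 0.
Lemma eAK_lie_linear_l v : linear (eAK_lie^~ v).
Proof. by move=> c u w; rewrite /eAK_lie scaler0 addr0. Qed.
Lemma eAK_lie_linear_r v : linear (eAK_lie v).
Proof. by move=> c u w; rewrite /eAK_lie scaler0 addr0. Qed.
Lemma eAK_liexx u : eAK_lie u u = 0. Proof. by []. Qed.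
Lemma eAK_jacobi u v w :
  eAK_lie u (eAK_lie v w) + eAK_lie v (eAK_lie w u) + eAK_lie w (eAK_lie u v)
    = 0.
Proof. by rewrite /eAK_lie !addr0. Qed.
HB.instance Definition _ := Lmodule_isLieAlgebra.Build k eAK
  eAK_lie_linear_l eAK_lie_linear_r eAK_liexx eAK_jacobi.

Definition e_tens (a : laurent k^o) : laurent (sl2 k) :=
  [malg n in msupp a => (a@_n : k) *: sl2_e].

Lemma e_tens_coef a n : (e_tens a)@_n = (a@_n : k) *: sl2_e.
Proof. by rewrite mcoeffE; case: msuppP => //; rewrite scale0r. Qed.

Lemma e_tens_linear : linear e_tens.
Proof.
move=> c a b; apply/malgP => n.
rewrite [RHS]mcoeffD laurent_coefZ !e_tens_coef [(c *: a + b)@_n]mcoeffD.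
by rewrite laurent_coefZ scalerDl scalerA.
Qed.

Lemma e_tens_inj : injective e_tens.
Proof.
move=> a b eq_ab; apply/malgP => n.
have := congr1 (fun w : laurent (sl2 k) => w@_n) eq_ab.
rewrite /= !e_tens_coef => /(congr1 (fun x : sl2 k => (x : 'M_2) 0 1)).
by rewrite /= !mxE /= !mulr1.
Qed.

Variable B : inv_form (sl2 k).

Definition eAK_emb (u : eAK) : affine B := (e_tens u.1, u.2).

Lemma eAK_emb_linear : linear eAK_emb.
Proof. by move=> c u v; congr (_, _); apply: e_tens_linear. Qed.

Lemma form_ee : B sl2_e sl2_e = 0.
Proof.
have := inv_form_lie B sl2_h sl2_e sl2_e.
rewrite liexx form0r lie_he formZl => /eqP; rewrite mulf_eq0 pnatr_eq0 /=.
by move/eqP.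
Qed.

Lemma eAK_emb_lie u v : eAK_emb (lie u v) = lie (eAK_emb u) (eAK_emb v).
Proof.
have -> : eAK_emb (lie u v) = 0.
  congr (_, _); apply/malgP => n.
  by rewrite e_tens_coef !mcoeff0 scale0r.
apply/esym; congr (_, _) => /=; apply: big1 => m _; apply: big1 => n _.
  by rewrite !e_tens_coef lieZl lieZr liexx !scaler0 tmon0.
by rewrite !e_tens_coef formZl formZr form_ee !mulr0 if_same.
Qed.

Definition eAK_hom : lie_hom eAK (affine B) := LieHom eAK_emb_linear eAK_emb_lie.
End EAK.

(* phi and kdot are phantom arguments of the type: only the action of the
   enveloping algebra depends on them. *)
Definition whit_line (k : numFieldType) (phi : {scalar (laurent k^o)}) (kdot : k)
  : Type := k.

Section Whittaker.
Variables (k : numFieldType) (B : inv_form (sl2 k)).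
Variables (phi : {scalar (laurent k^o)}) (kdot : k).

Definition whit_char (u : eAK k) : k^o := phi u.1 + kdot * u.2.

Lemma whit_char_linear : linear whit_char.
Proof.
move=> c u v; rewrite /whit_char /= linearP /= mulrDr scalerDr.
by rewrite mulrCA -!addrA; congr (_ + _); rewrite addrCA.
Qed.
Lemma whit_char_lie u v : whit_char (lie u v) =
  whit_char u * whit_char v - whit_char v * whit_char u.
Proof.
by rewrite [whit_char u * _]mulrC subrr /whit_char linear0 mulr0 addr0.
Qed.

Definition whit_rep : lie_rep (eAK k) k^o :=
  LieRep whit_char_linear whit_char_lie.


Local Notation line := (whit_line phi kdot).
HB.instance Definition _ := GRing.Zmodule.on line.

Definition whit_act (u : uea (eAK k)) (w : line) : line :=
  uea_lift whit_rep u * w.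

Lemma whit_actA u v w : whit_act u (whit_act v w) = whit_act (u * v) w.
Proof. by rewrite /whit_act rmorphM /= mulrA. Qed.
Lemma whit_act1 : left_id 1 whit_act.
Proof. by move=> w; rewrite /whit_act rmorph1 mul1r. Qed.
Lemma whit_actDr : right_distributive whit_act +%R.
Proof. by move=> u v w; rewrite /whit_act mulrDr. Qed.
Lemma whit_actDl w : {morph whit_act^~ w : u v / u + v}.
Proof. by move=> u v; rewrite /whit_act rmorphD mulrDl. Qed.
HB.instance Definition _ := GRing.Zmodule_isLmodule.Build (uea (eAK k)) line
  whit_actA whit_act1 whit_actDr whit_actDl.

Lemma whit_scaleE (u : uea (eAK k)) (w : line) :
  u *: w = uea_lift whit_rep u * w.
Proof. by []. Qed.

Definition whittaker := ext_scalars (uea_map (eAK_hom B)) line.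
HB.instance Definition _ := GRing.Lmodule.on whittaker.

Definition whit_vec : whittaker := tens _ 1 (1 : line).

Lemma whit_vecE (u : eAK k) :
  uea_gen (eAK_hom B u) *: whit_vec = (whit_char u)%:A *: whit_vec.
Proof.
have line_alg (c : k) : c%:A = uea_map (eAK_hom B) (c%:A).
  by rewrite linearZ rmorph1.
have bal s : tens (uea_map (eAK_hom B)) (uea_map (eAK_hom B) s) (1 : line) =
    tens _ 1 (s *: (1 : line)).
  by rewrite -tens_bal mul1r.
rewrite !scale_tens !mulr1 -uea_map_gen line_alg !bal.
have lift_gen : uea_lift whit_rep (uea_gen u) = whit_char u.
  by rewrite uea_lift_gen.
have lift_alg : uea_lift whit_rep (whit_char u)%:A = whit_char u.
  by rewrite linearZ rmorph1; apply: mulr1.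
by rewrite !whit_scaleE lift_gen lift_alg.
Qed.

End Whittaker.

Definition exp_polynomial (k : fieldType) (chi : {scalar (laurent k^o)}) : Prop :=
  exists (d : nat) (L : seq k) (c : nat -> k -> k),
    [/\ uniq L, 0 \notin L &
      forall n : int, chi (tmon (1 : k^o) n) =
        \sum_(j < d) \sum_(l <- L) c j l * n%:~R ^+ j * l ^ n].

(* Main.v *)
Require Import Defs.
From HB Require Import structures.
From mathcomp Require Import all_boot all_order all_algebra.
From mathcomp Require Import finmap ring zify.
From mathcomp Require Import boolp functions reals.
From mathcomp.real_closed Require Import complex.
From mathcomp.multinomials Require Import monalg.

Set Implicit Arguments.
Unset Strict Implicit.
Unset Printing Implicit Defensive.

Import Order.TTheory GRing.Theory Num.Theory.
Local Open Scope ring_scope.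

(** Write A for the ring of Laurent polynomials, W for the Whittaker module and w
   for its generator. The values phi(t^n) of an exponential polynomial are exactly
   the sequences that satisfy a linear recurrence, that is, phi is an exponential
   polynomial if and only if it vanishes on P A for some nonzero P
   ([recurrence_expseq], [expseq_recurrence]). Otherwise the pairing
   (p, q) |-> phi(p q) on A is nondegenerate.

   Suppose that the pairing is nondegenerate. The module W is spanned by the words
   in the h t^n and f t^n, applied to w. Give weight 1 to the h t^n and weight 2 to
   the f t^n. Modulo words of smaller weight the letters commute ([word_perm]), so
   that an expression of weight D has a symbol, a polynomial in commuting
   variables. The operator e t^n - phi(t^n) lowers the weight, and acts on symbols
   as the derivation f t^m |-> h t^(m + n), h t^m |-> - 2 phi(t^(m + n))
   ([e_word_sym]). No nonzero polynomial of positive weight is killed by all these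
   derivations ([null_dsyms]). Hence repeated application of such operators takes
   any nonzero vector of W to a nonzero multiple of w ([symbol_null],
   [proper_ideal_min]), and no proper submodule other than 0 exists.

   That W is nonzero, and the converse, come from a module coinduced from the
   subalgebra spanned by the h t^n, the f t^n and K. Its elements are functions of
   commutative words in the e t^n with values in a module H of the Heisenberg
   algebra of the h t^n and K, on which the f t^n act by 0. For every G in H the
   function s |-> phi(s_1) ... phi(s_r) G is a vector on which the e t^n and K act as
   on w ([coind_rep_e], [coind_rep_central]), whence a morphism from W
   ([whittaker_lift]). If phi vanishes on P A, with P made of negative powers of t,
   then h (x) P acts on this vector as it acts on G ([coind_rep_hP]), and there are
   eigenvectors G of any eigenvalue c ([heis_eigenE]). If W were simple, these
   morphisms would be injective: c = 0 yields (h (x) P) w = 0, which contradicts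
   c = 1. *)

(** * Exponential polynomials and linear recurrences *)

Section ShiftPolynomials.
Variable k : comNzRingType.
Implicit Types (psi : int -> k) (P Q : {poly k}).

(** The action of P as a polynomial in the shift psi |-> psi (_ + 1). *)
Definition pact P psi (n : int) : k := \sum_(i < size P) P`_i * psi (n + i%:Z).

Lemma pactE N P psi n : (size P <= N)%N ->
  pact P psi n = \sum_(i < N) P`_i * psi (n + i%:Z).
Proof.
move=> leN; rewrite /pact (big_ord_widen _ (fun i => P`_i * psi (n + i%:Z)) leN).
rewrite big_mkcond; apply: eq_bigr => i _; case: ltnP => // le.
by rewrite nth_default // mul0r.
Qed.

Lemma pactD P Q psi n : pact (P + Q) psi n = pact P psi n + pact Q psi n.
Proof.
rewrite (pactE _ _ (size_polyD P Q)) (pactE _ _ (leq_maxl _ (size Q))).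
rewrite (pactE _ _ (leq_maxr (size P) _)) -big_split; apply: eq_bigr => i _.
by rewrite coefD mulrDl.
Qed.

Lemma pactZ c P psi n : pact (c *: P) psi n = c * pact P psi n.
Proof.
rewrite (pactE _ _ (size_scale_leq c P)) mulr_sumr; apply: eq_bigr => i _.
by rewrite coefZ mulrA.
Qed.

Lemma pact0 psi n : pact 0 psi n = 0.
Proof. by rewrite /pact size_poly0 big_ord0. Qed.

Lemma pactMX P psi n : pact (P * 'X) psi n = pact P psi (n + 1).
Proof.
have [->|P0] := eqVneq P 0; first by rewrite mul0r !pact0.
rewrite /pact size_mulX // big_ord_recl coefMX mul0r add0r.
apply: eq_bigr => i _; by rewrite coefMX lift0 /= -addrA -intS.
Qed.

Lemma pactXn i psi n : pact 'X^i psi n = psi (n + i%:Z).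
Proof.
elim: i n => [|i IH] n.
  by rewrite expr0 /pact size_poly1 big_ord1 coef1 mul1r.
by rewrite exprSr pactMX IH -addrA -intS.
Qed.

Lemma pactC c psi n : pact c%:P psi n = c * psi n.
Proof. by rewrite -alg_polyC pactZ -(expr0 'X) pactXn addr0. Qed.

Lemma pactM P Q psi n : pact (P * Q) psi n = pact P (pact Q psi) n.
Proof.
elim/poly_ind: P n => [|P c IH] n; first by rewrite mul0r !pact0.
rewrite mulrDl mul_polyC pactD pactZ mulrAC pactMX IH.
by rewrite pactD pactMX pactC.
Qed.

Lemma pact_eq0 P psi : (forall n, psi n = 0) -> forall n, pact P psi n = 0.
Proof. by move=> psi0 n; rewrite /pact big1 // => i _; rewrite psi0 mulr0. Qed.

Lemma pactXsubC a psi n : pact ('X - a%:P) psi n = psi (n + 1) - a * psi n.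
Proof.
by rewrite pactD -polyCN pactC -(expr1 'X) pactXn mulNr.
Qed.

End ShiftPolynomials.

Section ExpSeq.
Variable k : numClosedFieldType.
Implicit Types (psi chi : int -> k) (P Q : {poly k}).

(** The sequences phi(t^n), for phi an exp_polynomial functional. *)
Definition expseq psi : Prop :=
  exists (d : nat) (L : seq k) (c : nat -> k -> k),
    [/\ uniq L, 0 \notin L &
      forall n : int, psi n =
        \sum_(j < d) \sum_(l <- L) c j l * n%:~R ^+ j * l ^ n].

(** The degree bound and the set of bases of an exponential polynomial can be
   enlarged, so that two of them have a common shape. *)
Lemma expseq_pad psi d L (c : nat -> k -> k) d' L' : uniq L -> uniq L' -> {subset L <= L'} ->
  (d <= d')%N ->
  (forall n, psi n = \sum_(j < d) \sum_(l <- L) c j l * n%:~R ^+ j * l ^ n) ->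
  forall n, psi n = \sum_(j < d') \sum_(l <- L')
    ((j < d)%:R * (l \in L)%:R * c j l) * n%:~R ^+ j * l ^ n.
Proof.
move=> uL uL' LL' dd' psiE n; rewrite psiE (big_ord_widen _ (fun j => \sum_(l <- L)
  c j l * n%:~R ^+ j * l ^ n) dd') big_mkcond; apply: eq_bigr => j _.
case: ifP => jd; last by rewrite big1 // => l _; rewrite !mul0r.
rewrite [RHS](bigID (mem L)) /= [X in _ = _ + X]big1 ?addr0 => [|l /negPf->].
  rewrite (perm_big [seq l <- L' | l \in L]) ?big_filter.
    by apply: eq_bigr => l lL; rewrite lL !mul1r.
  apply: uniq_perm; rewrite ?filter_uniq // => l; rewrite mem_filter.
  by case: (boolP (l \in L)) => // /LL'->.
by rewrite mulr0 !mul0r.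
Qed.

Lemma expseqD psi chi : expseq psi -> expseq chi -> expseq (fun n => psi n + chi n).
Proof.
case=> [d1 [L1 [c1 [u1 z1 E1]]]] [d2 [L2 [c2 [u2 z2 E2]]]].
pose L := undup (L1 ++ L2); have uL : uniq L by apply: undup_uniq.
have s1 : {subset L1 <= L} by move=> l lL; rewrite mem_undup mem_cat lL.
have s2 : {subset L2 <= L} by move=> l lL; rewrite mem_undup mem_cat lL orbT.
exists (maxn d1 d2), L, (fun j l => (j < d1)%:R * (l \in L1)%:R * c1 j l +
  (j < d2)%:R * (l \in L2)%:R * c2 j l).
split=> // [|n]; first by rewrite mem_undup mem_cat negb_or z1.
rewrite (expseq_pad u1 uL s1 (leq_maxl d1 d2) E1).
rewrite (expseq_pad u2 uL s2 (leq_maxr d1 d2) E2) -big_split /=.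
apply: eq_bigr => j _; rewrite -big_split /=; apply: eq_bigr => l _.
by rewrite !mulrDl.
Qed.

Lemma expseqZ a psi : expseq psi -> expseq (fun n => a * psi n).
Proof.
case=> [d [L [c [u z E]]]]; exists d, L, (fun j l => a * c j l).
split=> // n; rewrite E mulr_sumr; apply: eq_bigr => j _.
by rewrite mulr_sumr; apply: eq_bigr => l _; rewrite !mulrA.
Qed.

Lemma expseq0 : expseq (fun=> 0).
Proof. by exists 0%N, [::], (fun _ _ => 0); split=> // n; rewrite big_ord0. Qed.

Lemma eq_expseq psi chi : psi =1 chi -> expseq psi -> expseq chi.
Proof. by move=> /funext->. Qed.

Lemma expseq_sum (I : Type) (r : seq I) (F : I -> int -> k) :
  (forall i, expseq (F i)) -> expseq (fun n => \sum_(i <- r) F i n).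
Proof.
move=> FF; elim: r => [|i r IH].
  by apply: eq_expseq expseq0 => n; rewrite big_nil.
by apply: eq_expseq (expseqD (FF i) IH) => n; rewrite big_cons.
Qed.

Definition expmon (j : nat) (l : k) (n : int) : k := n%:~R ^+ j * l ^ n.

Lemma expseq_mon j l : l != 0 -> expseq (expmon j l).
Proof.
move=> l0; exists j.+1, [:: l], (fun i _ => (i == j)%:R).
split=> [||n]; rewrite ?inE 1?eq_sym // big_ord_recr /= big_seq1 eqxx mul1r.
by rewrite big1 ?add0r // => i _; rewrite big_seq1 ltn_eqF // !mul0r.
Qed.

Lemma expmon_shift j l n : l != 0 ->
  expmon j l (n + 1) = l * \sum_(i < j.+1) 'C(j, i)%:R * expmon i l n.
Proof.
move=> l0; rewrite /expmon intrD expfzDr // expr1z (addrC n%:~R) exprDn.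
rewrite (mulrC (l ^ n)) mulrCA; congr (_ * _).
rewrite mulr_suml; apply: eq_bigr => i _.
by rewrite expr1n mul1r -mulr_natl mulrA.
Qed.

(** The operator psi |-> (n |-> psi (n + 1) - a psi n) is triangular on the
   n^j l^n for fixed l, with diagonal entry l - a. If a = l it lowers the degree
   by exactly one, so that n^(j + 1) l^n has to be used. *)
Lemma expmon_shift_onto a l j : l != 0 ->
  exists2 psi, expseq psi & forall n, psi (n + 1) - a * psi n = expmon j l n.
Proof.
move=> l0; elim/ltn_ind: j => j IH.
have [G GE] : exists G : nat -> int -> k, forall i, (i < j)%N ->
    expseq (G i) /\ forall n, G i (n + 1) - a * G i n = expmon i l n.
  have [i|G GP] := choice (P := fun i (g : int -> k) => (i < j)%N ->
    expseq g /\ forall n, g (n + 1) - a * g n = expmon i l n).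
    have [/IH[g Eg gE]|_] := ltnP i j; first by exists g.
    by exists (fun=> 0).
  by exists G.
pose Sum (c : 'I_j -> k) (n : int) : k := \sum_(i < j) c i * G i n.
have sumG c : expseq (Sum c) /\
    forall n, Sum c (n + 1) - a * Sum c n = \sum_(i < j) c i * expmon i l n.
  split; first by apply: expseq_sum => i; apply/expseqZ; case: (GE i).
  move=> n; rewrite mulr_sumr -sumrB; apply: eq_bigr => i _.
  by rewrite mulrCA -mulrBr; congr (_ * _); case: (GE i) => // _; apply.
have ml (c : 'I_j -> k) n :
    \sum_(i < j) l * c i * expmon i l n = l * \sum_(i < j) c i * expmon i l n.
  by rewrite mulr_sumr; apply: eq_bigr => i _; rewrite mulrA.
have [la|la] := eqVneq l a.
  have [ES SE] := sumG (fun i => l * 'C(j.+1, i)%:R); set S := Sum _ in ES SE.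
  have c0 : l * j.+1%:R != 0 by rewrite mulf_neq0 // pnatr_eq0.
  exists (fun n => (l * j.+1%:R)^-1 * (expmon j.+1 l n + (-1) * S n)).
    by apply/expseqZ/expseqD/expseqZ => //; apply: expseq_mon.
  move=> n; apply: (mulfI c0); rewrite mulrBr (mulrCA a) !(mulVKf c0).
  rewrite expmon_shift // !big_ord_recr /= binn mul1r binSn.
  have /eqP := SE n; rewrite subr_eq => /eqP->.
  by rewrite -la ml; ring.
have [ES SE] := sumG (fun i => l * 'C(j, i)%:R); set S := Sum _ in ES SE.
have c0 : l - a != 0 by rewrite subr_eq0.
exists (fun n => (l - a)^-1 * (expmon j l n + (-1) * S n)).
  by apply/expseqZ/expseqD/expseqZ => //; apply: expseq_mon.
move=> n; apply: (mulfI c0); rewrite mulrBr (mulrCA a) !(mulVKf c0).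
rewrite expmon_shift // !big_ord_recr /= binn mul1r.
have /eqP := SE n; rewrite subr_eq => /eqP->.
by rewrite ml; ring.
Qed.

Lemma expseq_shift_onto a chi : expseq chi ->
  exists2 psi, expseq psi & forall n, psi (n + 1) - a * psi n = chi n.
Proof.
case=> [d [L [c [uL zL E]]]].
have [[j l]|G GP] := choice (P := fun (p : nat * k) (g : int -> k) => expseq g /\
    (p.2 != 0 -> forall n, g (n + 1) - a * g n = expmon p.1 p.2 n)).
  have [->|l0] := eqVneq l 0.
    by exists (fun=> 0); split=> [|/eqP//]; apply: expseq0.
  by have [g Eg gE] := expmon_shift_onto a j l0; exists g.
exists (fun n => \sum_(j < d) \sum_(l <- L) c j l * G (nat_of_ord j, l) n).
  apply: expseq_sum => j; apply: expseq_sum => l.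
  by apply: (expseqZ (c j l)) (GP (nat_of_ord j, l)).1.
move=> n; rewrite mulr_sumr -sumrB E; apply: eq_bigr => j _.
rewrite mulr_sumr -sumrB big_seq [RHS]big_seq; apply: eq_bigr => l lL.
rewrite mulrCA -mulrBr -mulrA; congr (_ * _); case: (GP (nat_of_ord j, l)) => _; apply.
by apply: contraNneq zL => <-.
Qed.

(** Two sequences psi with the same differences psi (n + 1) - a psi n differ by
   a multiple of a^n, so that expseq_shift_onto applies. *)
Lemma expseq_shift a psi : expseq (fun n => psi (n + 1) - a * psi n) -> expseq psi.
Proof.
case/(expseq_shift_onto a) => psi0 E0 psi0E; pose del n := psi n - psi0 n.
have delS n : del (n + 1) = a * del n.
  have /eqP := psi0E n; rewrite subr_eq => /eqP delE; rewrite /del delE; ring.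
suff Edel : expseq del.
  by apply: eq_expseq (expseqD Edel E0) => n; rewrite /del subrK.
have [a0|a0] := eqVneq a 0.
  by apply: eq_expseq expseq0 => n; rewrite -[n](subrK 1) delS a0 mul0r.
apply: eq_expseq (expseqZ (del 0) (expseq_mon 0 a0)) => n.
rewrite /expmon expr0 mul1r mulrC; elim/int_ind: n => [|n IH|n IH].
- by rewrite expr0z mul1r.
- by rewrite intS addrC delS -IH exprzDr ?unitfE // expr1z; ring.
apply: (mulfI a0); rewrite -delS intS opprD addrAC addNr add0r -IH mulrA.
by rewrite -[X in X * _ * _]expr1z -exprzDr ?unitfE // addNKr.
Qed.

(** P splits into linear factors, which expseq_shift removes one by one. *)
Lemma pact_expseq P psi : P != 0 -> (forall n, pact P psi n = 0) -> expseq psi.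
Proof.
move=> P0; have [rs Prs] := closed_field_poly_normal P.
have lP : lead_coef P != 0 by rewrite lead_coef_eq0.
move=> Ppsi; have {Ppsi Prs P0} : forall n, pact (\prod_(z <- rs) ('X - z%:P)) psi n = 0.
  by move=> n; apply: (mulfI lP); rewrite -pactZ -Prs Ppsi mulr0.
elim: rs psi => [|r rs IH] psi.
  move=> psi0; apply: eq_expseq expseq0 => n.
  by rewrite -(psi0 n) big_nil -[1]/1%:P pactC mul1r.
rewrite big_cons mulrC => psi0; apply: (@expseq_shift r); apply: IH => n.
rewrite -(psi0 n) pactM; congr pact; apply/funext => m.
by rewrite pactXsubC.
Qed.

(** Translating by a large B makes all the shifts nonnegative. *)
Lemma recurrence_expseq (s : seq int) (c : int -> k) psi : uniq s ->
  (forall n, \sum_(m <- s) c m * psi (n + m) = 0) ->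
  (exists2 m, m \in s & c m != 0) -> expseq psi.
Proof.
move=> us psi0 [m0 m0s cm0].
pose B : nat := \sum_(m <- s) `|m|%N.
have leB m : m \in s -> (`|m| <= B)%N.
  by move=> ms; rewrite /B (perm_big _ (perm_to_rem ms)) big_cons leq_addr.
pose ex (m : int) : nat := absz (m + B%:Z).
have exE m : m \in s -> (ex m)%:Z = m + B%:Z.
  by move=> /leB; rewrite /ex; lia.
pose P := \sum_(m <- s) c m *: 'X^(ex m) : {poly k}.
apply: (@pact_expseq P) => [|n].
  apply: contra_neq cm0 => P0.
  have : P`_(ex m0) = 0 by rewrite P0 coef0.
  rewrite coef_sum (bigD1_seq m0) //= coefZ coefXn eqxx mulr1.
  rewrite big_seq_cond big1 ?addr0 // => m /andP[ms nm].
  rewrite coefZ coefXn; case: eqP => [Eex|]; rewrite ?mulr0 //.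
  case/eqP: nm; apply: (addIr B%:Z); rewrite -!exE //; congr Posz; exact: esym.
have -> : pact P psi n = \sum_(m <- s) c m * pact 'X^(ex m) psi n.
  rewrite /P; elim: (s) => [|m s' IH]; first by rewrite !big_nil pact0.
  by rewrite !big_cons pactD pactZ IH.
rewrite -[RHS](psi0 (n + B%:Z)) big_seq [RHS]big_seq; apply: eq_bigr => m ms.
by rewrite pactXn exE // addrAC addrA.
Qed.

(** X - l lowers the degree in n of the multiples of l^n. *)
Lemma pact_expmon l d j n : l != 0 -> (j < d)%N ->
  pact (('X - l%:P) ^+ d) (expmon j l) n = 0.
Proof.
move=> l0; elim: d j n => // d IH j n jd; rewrite exprSr pactM.
have -> : pact ('X - l%:P) (expmon j l) =
    (fun n => \sum_(i < j) (l * 'C(j, i)%:R) * expmon i l n).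
  apply/funext => m; rewrite pactXsubC expmon_shift // big_ord_recr /= binn mul1r.
  by rewrite mulrDr addrK mulr_sumr; apply: eq_bigr => i _; rewrite mulrA.
rewrite {1}/pact; under eq_bigr do rewrite mulr_sumr.
rewrite exchange_big big1 //= => i _.
transitivity ((l * 'C(j, i)%:R) * pact (('X - l%:P) ^+ d) (expmon i l) n).
  by rewrite /pact mulr_sumr; apply: eq_bigr => m _; rewrite mulrCA.
by rewrite IH ?mulr0 // (leq_trans (ltn_ord i)).
Qed.

Lemma expseq_recurrence psi : expseq psi ->
  exists2 P : {poly k}, P != 0 & forall n, pact P psi n = 0.
Proof.
case=> [d [L [c [uL zL E]]]]; exists (\prod_(l <- L) ('X - l%:P) ^+ d).
  by rewrite prodf_seq_neq0; apply/allP => l _ /=; rewrite expf_neq0 // polyXsubC_eq0.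
move=> n; rewrite (_ : psi = fun n => \sum_(j < d) \sum_(l <- L) c j l * expmon j l n).
  rewrite /pact /=; under eq_bigr do rewrite mulr_sumr.
  rewrite exchange_big big1 //= => j _; under eq_bigr do rewrite mulr_sumr.
  rewrite exchange_big big_seq big1 //= => l lL.
  set P := \prod_(_ <- _) _.
  transitivity (c j l * pact P (expmon j l) n).
    by rewrite /pact mulr_sumr; apply: eq_bigr => m _; rewrite mulrCA.
  rewrite /P (perm_big _ (perm_to_rem lL)) big_cons /=.
  rewrite [X in pact X _ _]mulrC pactM (pact_eq0 _ (psi := pact _ _)) ?mulr0 // => m.
  by rewrite pact_expmon //; apply: contraNneq zL => <-.
apply/funext => m; rewrite E; apply: eq_bigr => j _; apply: eq_bigr => l _.
by rewrite /expmon mulrA.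
Qed.
End ExpSeq.

(** * Words in the h t^n and f t^n, and the symbols of the e t^n *)

Definition left_ideal (A : nzRingType) (I : A -> Prop) : Prop :=
  [/\ I 0, forall x y, I x -> I y -> I (x - y) & forall a x, I x -> I (a * x)].

Section LeftIdeal.
Variables (A : nzRingType) (I : A -> Prop) (idI : left_ideal I).

Lemma lideal0 : I 0. Proof. by case: idI. Qed.
Lemma lidealB x y : I x -> I y -> I (x - y). Proof. by case: idI => _ + _; apply. Qed.
Lemma lidealM a x : I x -> I (a * x). Proof. by case: idI => _ _; apply. Qed.
Lemma lidealN x : I x -> I (- x).
Proof. by rewrite -(sub0r x); apply/lidealB/lideal0. Qed.
Lemma lidealD x y : I x -> I y -> I (x + y).
Proof. by move=> Ix Iy; rewrite -[y]opprK; apply/lidealB/lidealN. Qed.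
End LeftIdeal.

Lemma lidealZ (k : fieldType) (A : algType k) (I : A -> Prop) c x :
  left_ideal I -> I x -> I (c *: x).
Proof. by move=> idI; rewrite -mulr_algl; apply: lidealM. Qed.

(** A letter (true, n) stands for f t^n and (false, n) for h t^n. *)
Definition letter := (bool * int)%type.

(** With these weights every commutator of two letters has smaller weight than
   the product, and e t^n - phi(t^n) lowers the weight: f t^m becomes
   h t^(m + n), while h t^m becomes a scalar. *)
Definition lwt (x : letter) : nat := x.1.+1.
Definition wwt (l : seq letter) : nat := \sum_(x <- l) lwt x.

Lemma wwt_cons x l : wwt (x :: l) = (lwt x + wwt l)%N.
Proof. by rewrite /wwt big_cons. Qed.
Lemma wwt_nil : wwt [::] = 0%N. Proof. by rewrite /wwt big_nil. Qed.
Lemma perm_wwt l l' : perm_eq l l' -> wwt l = wwt l'.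
Proof. exact: perm_big. Qed.

(** In the enveloping algebra of the affine algebra, e n, h n and f n stand for e t^n,
   h t^n and f t^n, and z for K; J is the annihilator of a vector on which e t^n acts
   by phi n and K by kdot. *)
Section Words.
Variables (k : numFieldType) (A : algType k).
Variables (e h f : int -> A) (z : A).
Variables (phi : int -> k) (kdot : k) (c_ef c_hh : int -> int -> k).

Hypothesis ef : forall m n, e m * f n = f n * e m + h (m + n) + c_ef m n *: z.
Hypothesis eh : forall m n, e m * h n = h n * e m - 2 *: e (m + n).
Hypothesis hf : forall m n, h m * f n = f n * h m - 2 *: f (m + n).
Hypothesis hh : forall m n, h m * h n = h n * h m + c_hh m n *: z.
Hypothesis ff : forall m n, f m * f n = f n * f m.
Hypothesis zC : forall a, z * a = a * z.

Variable J : A -> Prop.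
Hypothesis idJ : left_ideal J.
Hypothesis Je : forall n, J (e n - (phi n)%:A).
Hypothesis Jz : J (z - kdot%:A).

Let J0 := lideal0 idJ.
Let JB := lidealB idJ.
Let JD := lidealD idJ.
Let JM := lidealM idJ.
Let JZ c x := @lidealZ k A J c x idJ.

Definition gen (x : letter) : A := if x.1 then f x.2 else h x.2.
Definition word (l : seq letter) : A := \prod_(x <- l) gen x.

Lemma word_cons x l : word (x :: l) = gen x * word l.
Proof. by rewrite /word big_cons. Qed.
Lemma word_nil : word [::] = 1. Proof. by rewrite /word big_nil. Qed.

(** Lists of pairs stand for formal linear combinations of words; the symbol of
   an element is the class of such a list in the commutative polynomials. *)
Definition wsum (L : seq (k * seq letter)) : A :=
  \sum_(p <- L) p.1 *: word p.2.

Lemma wsum_cat L L' : wsum (L ++ L') = wsum L + wsum L'.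
Proof. by rewrite /wsum big_cat. Qed.

Definition wscale (c : k) (L : seq (k * seq letter)) :=
  [seq (c * p.1, p.2) | p <- L].
Lemma wsum_scale c L : wsum (wscale c L) = c *: wsum L.
Proof.
by rewrite /wsum big_map scaler_sumr; apply: eq_bigr => p _; rewrite scalerA.
Qed.

Definition wcons (x : letter) (L : seq (k * seq letter)) :=
  [seq (p.1, x :: p.2) | p <- L].
Lemma wsum_cons x L : wsum (wcons x L) = gen x * wsum L.
Proof.
rewrite /wsum big_map mulr_sumr; apply: eq_bigr => p _ /=.
by rewrite word_cons scalerAr.
Qed.

(** The filtration by weight, taken modulo J. *)
Definition infilt (D : nat) (u : A) : Prop :=
  exists2 L, all (fun p => wwt p.2 < D)%N L & J (u - wsum L).

Lemma infiltJ D u : J u -> infilt D u.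
Proof. by exists [::]; rewrite // /wsum big_nil subr0. Qed.

Lemma infilt0 u : infilt 0 u -> J u.
Proof. by case=> [[|p L]] //; rewrite /wsum big_nil subr0. Qed.

Lemma infilt_le D D' u : (D <= D')%N -> infilt D u -> infilt D' u.
Proof.
move=> le [L allL JL]; exists L => //; apply: sub_all allL => p lt_p.
exact: leq_trans lt_p le.
Qed.

Lemma infiltD D u v : infilt D u -> infilt D v -> infilt D (u + v).
Proof.
case=> [L aL JL] [L' aL' JL']; exists (L ++ L'); first by rewrite all_cat aL.
by rewrite wsum_cat opprD addrACA; apply: JD.
Qed.

Lemma infiltZ D c u : infilt D u -> infilt D (c *: u).
Proof.
case=> [L aL JL]; exists (wscale c L); first by rewrite all_map; apply: sub_all aL.
by rewrite wsum_scale -scalerBr; apply: JZ.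
Qed.

Lemma infiltN D u : infilt D u -> infilt D (- u).
Proof. by rewrite -scaleN1r; apply: infiltZ. Qed.

Lemma infiltB D u v : infilt D u -> infilt D v -> infilt D (u - v).
Proof. by move=> Fu Fv; apply/infiltD/infiltN. Qed.

Lemma infilt_sum (I : Type) (r : seq I) (P : pred I) (F : I -> A) D :
  (forall i, P i -> infilt D (F i)) -> infilt D (\sum_(i <- r | P i) F i).
Proof.
move=> FF; apply: big_ind => //; last exact: infiltD.
exact/infiltJ/J0.
Qed.

Lemma infilt_eq D u v : infilt D (u - v) -> infilt D v -> infilt D u.
Proof. by move=> Fuv Fv; rewrite -(subrK v u); apply: infiltD. Qed.

Lemma infilt_word D l : (wwt l < D)%N -> infilt D (word l).
Proof.
move=> lt_l; exists [:: (1, l)]; rewrite ?/= ?lt_l //.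
by rewrite /wsum big_seq1 scale1r subrr; apply: J0.
Qed.

Lemma infilt_gen D x u : infilt D u -> infilt (lwt x + D) (gen x * u).
Proof.
case=> [L aL JL]; exists (wcons x L).
  by rewrite all_map; apply: sub_all aL => p /=; rewrite wwt_cons ltn_add2l.
by rewrite wsum_cons -mulrBr; apply: JM.
Qed.

Lemma central_mod u : J (z * u - kdot *: u).
Proof. by rewrite zC -[kdot *: u]mulr_algr -mulrBr; apply: JM. Qed.

Lemma infilt_central D u : infilt D u -> infilt D (z * u).
Proof.
move=> Fu; apply: (@infilt_eq _ _ (kdot *: u)); last exact: infiltZ.
exact/infiltJ/central_mod.
Qed.

Lemma e_word_f n m l : e n * word ((true, m) :: l) - phi n *: word ((true, m) :: l) =
  f m * (e n * word l - phi n *: word l) + word ((false, n + m) :: l)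
  + c_ef n m *: (z * word l).
Proof.
rewrite !word_cons /gen /= mulrBr -[f m * (phi n *: _)]scalerAr !mulrA ef.
rewrite !mulrDl -!scalerAl -!addrA; congr (_ + _).
by rewrite addrC addrA [in RHS]addrC addrA.
Qed.

Lemma e_word_h n m l : e n * word ((false, m) :: l) - phi n *: word ((false, m) :: l) =
  h m * (e n * word l - phi n *: word l) - 2 *: (e (n + m) * word l).
Proof.
rewrite !word_cons /gen /= mulrBr -[h m * (phi n *: _)]scalerAr !mulrA eh.
by rewrite !mulrBl -!scalerAl addrAC.
Qed.

(** Moving e t^n to the right through a word replaces it by the scalar
   phi(t^n), up to words of smaller weight. *)
Lemma e_word n l : infilt (wwt l) (e n * word l - phi n *: word l).
Proof.
elim: l n => [|[[] m] l IH] n.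
- rewrite word_nil mulr1 wwt_nil; exact/infiltJ/Je.
- rewrite e_word_f wwt_cons; apply: infiltD; first apply: infiltD.
  + exact: (infilt_gen (true, m) (IH n)).
  + by apply: infilt_word; rewrite wwt_cons.
  + by apply/infiltZ/infilt_central/infilt_word; rewrite ltnS leqW.
rewrite e_word_h wwt_cons; apply: infiltB.
  exact: (infilt_gen (false, m) (IH n)).
apply: infiltZ; apply: (@infilt_eq _ _ (phi (n + m) *: word l)).
  exact: infilt_le (leq_addl _ _) (IH (n + m)).
exact/infiltZ/infilt_word.
Qed.

Lemma infilt_e n D u : infilt D.+1 u -> infilt D (e n * u - phi n *: u).
Proof.
case=> [L aL JL]; pose E v := e n * v - phi n *: v.
have EB v w : E v - E w = E (v - w).
  by rewrite /E opprD addrACA -opprD -mulrBr -scalerBr.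
apply: (@infilt_eq _ _ (E (wsum L))).
  by rewrite [X in X - _]/(E u) EB; apply/infiltJ/JB; [apply: JM | apply: JZ].
rewrite /E mulr_sumr scaler_sumr -sumrB big_seq; apply: infilt_sum => p pL.
rewrite -scalerAr scalerA mulrC -scalerA -scalerBr; apply/infiltZ.
by apply: infilt_le (e_word n p.2); have /allP/(_ p pL) := aL.
Qed.

(** The span of the words modulo J. *)
Definition spanned (u : A) : Prop := exists D, infilt D u.

Lemma spannedJ u : J u -> spanned u.
Proof. by exists 0%N; apply: infiltJ. Qed.

Lemma spanned1 : spanned 1.
Proof. by exists 1%N; rewrite -word_nil; apply: infilt_word; rewrite wwt_nil. Qed.

Lemma spanned_lin c u v : spanned u -> spanned v -> spanned (c *: u + v).
Proof.
move=> [D Fu] [D' Fv]; exists (maxn D D'); apply: infiltD.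
  by apply: infiltZ; apply: infilt_le Fu; apply: leq_maxl.
by apply: infilt_le Fv; apply: leq_maxr.
Qed.

Lemma spanned_gen x u : spanned u -> spanned (gen x * u).
Proof. by case=> D /(infilt_gen x) Fu; exists (lwt x + D)%N. Qed.

Lemma spanned_central u : spanned u -> spanned (z * u).
Proof. by case=> D Fu; exists D; apply: infilt_central. Qed.

Lemma spanned_e n u : spanned u -> spanned (e n * u).
Proof.
case=> D Fu; exists D; apply: (@infilt_eq _ _ (phi n *: u)); last exact: infiltZ.
by apply: infilt_e; apply: infilt_le Fu.
Qed.

(** The derivation f t^m |-> h t^(m + n), h t^m |-> - 2 phi(t^(m + n)), with one
   term for each letter of the word. *)
Fixpoint dsym (n : int) (l : seq letter) : seq (k * seq letter) :=
  if l is x :: l' then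
    (if x.1 then (1, (false, n + x.2) :: l') else (- 2 * phi (n + x.2), l'))
      :: wcons x (dsym n l')
  else [::].

Lemma dsym_wt n l : all (fun p => (wwt p.2).+1 == wwt l) (dsym n l).
Proof.
elim: l => [|x l IH] //=; apply/andP; split.
  by case: x => -[] m /=; rewrite !wwt_cons ?add1n ?add2n.
rewrite all_map; apply: sub_all IH => p /=; rewrite !wwt_cons => /eqP <-.
by rewrite addnS.
Qed.

(** Passing e t^n through a letter replaces the letter by its bracket with e t^n.
   For h t^m this is - 2 e t^(m + n), which e_word turns into a scalar; the central
   terms and the corrections of e_word have smaller weight. Thus the symbol of
   e t^n - phi(t^n) is a derivation. *)
Lemma e_word_sym n l :
  infilt (wwt l).-1 (e n * word l - phi n *: word l - wsum (dsym n l)).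
Proof.
elim: l => [|x l IH] /=.
  rewrite word_nil mulr1 /wsum big_nil subr0; exact/infiltJ/Je.
set E := (X in e n * word l - X) in IH.
have IHx : infilt (wwt (x :: l)).-1 (gen x * (e n * word l - E - wsum (dsym n l))).
  rewrite wwt_cons; case: (l) IH => [|y l'] IH.
    by move: IH; rewrite wwt_nil => /infilt0 IH; apply/infiltJ/JM.
  apply: infilt_le (infilt_gen x IH).
  by rewrite wwt_cons -(prednK (isT : 0 < lwt y)%N) addSn /= addnS.
have -> p : wsum (p :: wcons x (dsym n l)) = p.1 *: word p.2 + gen x * wsum (dsym n l).
  by rewrite -wsum_cons /wsum big_cons.
case: x IHx => -[] m IHx /=.
  rewrite e_word_f scale1r; apply: infilt_eq IHx; rewrite /gen /= -/E.
  rewrite [f m * (_ - wsum _)]mulrBr.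
  set a := f m * _; set b := word _; set c := c_ef _ _ *: _; set d := f m * _.
  have -> : a + b + c - (b + d) - (a - d) = c.
    apply/eqP; rewrite !subr_eq (addrC b d) addrA -[_ + d]addrA subrK.
    by rewrite [eqbLHS]addrC addrA.
  apply/infiltZ/infilt_central/infilt_word; rewrite wwt_cons /=; lia.
rewrite e_word_h; apply: infilt_eq IHx; rewrite /gen /= -/E.
rewrite [h m * (_ - wsum _)]mulrBr.
set a := h m * _; set d := h m * _; set b := e _ * _; set c := word l.
have -> : a - 2 *: b - ((-2 * phi (n + m)) *: c + d) - (a - d) =
    - 2 *: (b - phi (n + m) *: c).
  apply/eqP; rewrite !subr_eq (addrC _ d) addrA -[_ + d]addrA subrK.
  rewrite scalerBr scalerA.
  by rewrite [_ + a]addrC !addrA subrK -addrA scaleNr addNr addr0.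
by apply: infiltZ; rewrite wwt_cons; apply: e_word.
Qed.

Lemma word_swap x y l :
  infilt (wwt (x :: y :: l)) (word (x :: y :: l) - word (y :: x :: l)).
Proof.
rewrite !word_cons !mulrA -mulrBl.
have lt_l m : (wwt ((true, m) :: l) < wwt [:: x, y & l])%N -> 
    infilt (wwt [:: x, y & l]) (f m * word l).
  by move=> ltl; rewrite -[f m]/(gen (true, m)) -word_cons; apply: infilt_word.
case: x y lt_l => [[] m] [[] n] lt_l; rewrite /gen /=.
- by rewrite ff subrr mul0r; apply/infiltJ.
- rewrite hf opprB addrC subrK -scalerAl; apply/infiltZ/lt_l.
  by rewrite !wwt_cons.
- rewrite hf addrAC subrr add0r mulNr -scalerAl; apply/infiltN/infiltZ/lt_l.
  by rewrite !wwt_cons.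
rewrite hh addrAC subrr add0r -scalerAl.
by apply/infiltZ/infilt_central/infilt_word; rewrite !wwt_cons.
Qed.

Lemma word_bubble x l1 l2 :
  infilt (wwt (x :: l1 ++ l2)) (word (l1 ++ x :: l2) - word (x :: l1 ++ l2)).
Proof.
elim: l1 => [|y l1 IH] /=; first by rewrite subrr; apply/infiltJ.
apply: (@infilt_eq _ _ (gen y * (word (l1 ++ x :: l2) - word (x :: l1 ++ l2)))).
  rewrite mulrBr -!word_cons opprB addrC addrA subrK.
  rewrite (perm_wwt (_ : perm_eq _ (y :: x :: l1 ++ l2))); first exact: word_swap.
  by rewrite (perm_catCA [:: x] [:: y]).
by have := infilt_gen y IH; rewrite !wwt_cons addnCA.
Qed.

(** The commutator of two letters has smaller weight than their product. *)
Lemma word_perm l l' : perm_eq l l' -> infilt (wwt l) (word l - word l').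
Proof.
elim: l l' => [|x l IH] l' pll'.
  by move: pll'; rewrite perm_sym => /perm_nilP->; rewrite subrr; apply/infiltJ.
have xl' : x \in l' by rewrite -(perm_mem pll') mem_head.
case/splitPr: l' / xl' pll' => l1 l2 pll'.
have pl : perm_eq l (l1 ++ l2).
  by rewrite -(perm_cons x) (perm_trans pll') // -cat1s perm_catCA.
apply: (@infilt_eq _ _ (gen x * (word l - word (l1 ++ l2)))).
  rewrite mulrBr -!word_cons opprB addrC addrA subrK -opprB.
  apply: infiltN; rewrite (perm_wwt (_ : perm_eq _ (x :: l1 ++ l2))) ?perm_cons //.
  exact: word_bubble.
by have := infilt_gen x (IH _ pl); rewrite wwt_cons.
Qed.

(** Two formal combinations of words define the same commutative polynomial
   when no functional that ignores the order of letters separates them. *)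
Definition symf (T : Type) (g : seq letter -> T) : Prop :=
  forall l l', perm_eq l l' -> g l = g l'.

Definition fsum (L : seq (k * seq letter)) (g : seq letter -> k) : k :=
  \sum_(p <- L) p.1 * g p.2.

Definition null (L : seq (k * seq letter)) : Prop :=
  forall g, symf g -> fsum L g = 0.

(* a canonical representative of the words with the same letters as l *)
Let canon (l : seq letter) := choose (perm_eq l) l.

Let perm_canon l : perm_eq l (canon l).
Proof. by apply: chooseP; rewrite perm_refl. Qed.

Let canon_sym : symf canon.
Proof.
move=> l l' pll'; have eq_p : perm_eq l =1 perm_eq l' by apply/permPl.
rewrite /canon (eq_choose eq_p); apply: choose_id; rewrite ?perm_refl //.
by rewrite perm_sym.
Qed.

(** Once the words are grouped according to their letters, the coefficient of
   each group is the value of L on the indicator functional of the group. *)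
Lemma null_wsum D L :
  all (fun p => wwt p.2 == D) L -> null L -> infilt D (wsum L).
Proof.
move=> aL nL; pose T := undup [seq canon p.2 | p <- L].
apply: (@infilt_eq _ _ (\sum_(p <- L) p.1 *: word (canon p.2))).
  rewrite -sumrB big_seq; apply: infilt_sum => p pL; rewrite -scalerBr.
  apply: infiltZ; have /allP/(_ p pL)/eqP <- := aL.
  exact/word_perm/perm_canon.
suff -> : \sum_(p <- L) p.1 *: word (canon p.2) = 0 by apply/infiltJ.
transitivity (\sum_(p <- L) \sum_(s <- T) (p.1 * (canon p.2 == s)%:R) *: word s).
  rewrite big_seq [RHS]big_seq; apply: eq_bigr => p pL.
  rewrite (bigD1_seq (canon p.2)) ?undup_uniq ?mem_undup ?(map_f (fun q => canon q.2)) //=.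
  rewrite eqxx mulr1 big1 ?addr0 // => s; rewrite eq_sym => /negPf->.
  by rewrite mulr0 scale0r.
rewrite exchange_big big1 //= => s _; rewrite -scaler_suml.
have := nL (fun l => (canon l == s)%:R); rewrite /fsum => -> /=.
  by rewrite scale0r.
by move=> l l' /canon_sym->.
Qed.

(** * The common kernel of the symbols *)

Lemma perm_rem (x : letter) l l' : perm_eq l l' -> perm_eq (rem x l) (rem x l').
Proof.
move=> pll'; have [xl|xl] := boolP (x \in l); last first.
  by rewrite !rem_id // -?(perm_mem pll').
rewrite -(perm_cons x) -(permPl (perm_to_rem xl)) (perm_trans pll') //.
by rewrite -(permPr (perm_to_rem _)) // -(perm_mem pll').
Qed.

Lemma symf_cons (T : Type) (g : seq letter -> T) x : symf g -> symf (g \o cons x).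
Proof. by move=> sg l l' pll'; apply: sg; rewrite perm_cons. Qed.

(** On symmetric functionals, the transpose of the partial derivative with
   respect to the letter x. *)
Definition rmf (x : letter) (g : seq letter -> k) (l : seq letter) : k :=
  (count_mem x l)%:R * g (rem x l).

Lemma symf_rm x g : symf g -> symf (rmf x g).
Proof.
by move=> sg l l' pll'; rewrite /rmf (permP pll') (sg _ _ (perm_rem x pll')).
Qed.

Lemma sum_count (F : letter -> k) (S l : seq letter) : uniq S -> {subset l <= S} ->
  \sum_(x <- l) F x = \sum_(x <- S) (count_mem x l)%:R * F x.
Proof.
move=> uS; elim: l => [|y l IH] lS.
  by rewrite big_nil big1 // => x _; rewrite mul0r.
rewrite big_cons IH => [|x xl]; last by apply: lS; rewrite inE xl orbT.
rewrite [RHS](eq_bigr (fun x => (y == x)%:R * F x + (count_mem x l)%:R * F x)).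
  rewrite big_split /=; congr (_ + _).
  rewrite (bigD1_seq y) ?lS ?mem_head //= eqxx mul1r big1 ?addr0 //.
  by move=> x; rewrite eq_sym => /negPf->; rewrite mul0r.
by move=> x _; rewrite /= natrD mulrDl.
Qed.

(** The contribution to g of the image of the letter x under the derivation, when
   the other letters form the word l. *)
Definition dletter (n : int) (x : letter) (g : seq letter -> k) (l : seq letter) : k :=
  if x.1 then g ((false, n + x.2) :: l) else - 2 * phi (n + x.2) * g l.

Lemma fsum_dsym n l g : symf g ->
  fsum (dsym n l) g = \sum_(x <- l) dletter n x g (rem x l).
Proof.
elim: l g => [|y l IH] g sg; first by rewrite /fsum !big_nil.
rewrite [dsym n _]/= /fsum big_cons big_map big_cons /= eqxx.
have := IH _ (symf_cons y sg); rewrite /fsum /= => ->; congr (_ + _).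
  by rewrite /dletter; case: (y.1); rewrite ?mul1r.
rewrite big_seq [RHS]big_seq; apply: eq_bigr => x xl; rewrite /dletter /=.
have prem : perm_eq (y :: rem x l) (if y == x then l else y :: rem x l).
  by case: eqP => // ->; rewrite perm_sym perm_to_rem.
case: (x.1); last by rewrite (sg _ _ prem).
congr (_ * _) || apply: sg.
by rewrite -(permPr (_ : perm_eq ((false, n + x.2) :: y :: rem x l) _)) ?perm_cons //
  (perm_catCA [:: y] [:: _]).
Qed.

Definition dsyms (n : int) (L : seq (k * seq letter)) :=
  flatten [seq wscale p.1 (dsym n p.2) | p <- L].

Lemma fsum_dsyms n L g :
  fsum (dsyms n L) g = \sum_(p <- L) p.1 * fsum (dsym n p.2) g.
Proof.
rewrite /fsum big_flatten big_map; apply: eq_bigr => p _.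
by rewrite big_map mulr_sumr; apply: eq_bigr => q _; rewrite mulrA.
Qed.

Lemma wsum_dsyms n L :
  wsum (dsyms n L) = \sum_(p <- L) p.1 *: wsum (dsym n p.2).
Proof.
rewrite /wsum big_flatten big_map; apply: eq_bigr => p _.
by rewrite -wsum_scale /wsum.
Qed.

Lemma fresh_int (S : seq letter) : exists N : int, forall x, x \in S -> x.2 != N.
Proof.
exists (\sum_(x <- S) `|x.2| + 1); move=> x xS.
rewrite neq_lt; apply/orP; left; rewrite ltzD1.
rewrite (le_trans (ler_norm _)) // (perm_big _ (perm_to_rem xS)) big_cons /=.
by rewrite lerDl sumr_ge0.
Qed.

(** The pairing (p, q) |-> phi(p q) of Laurent polynomials is nondegenerate. *)
Hypothesis phi_nd : forall (s : seq int) (c : int -> k), uniq s ->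
  (forall n, \sum_(m <- s) c m * phi (n + m) = 0) -> forall m, m \in s -> c m = 0.

(** A polynomial of positive weight killed by all the derivations dsym n is 0.
   For n large, h t^(m + n) is a new variable, so that the derivative along
   f t^m must vanish; nondegeneracy then kills the derivatives along
   the h t^m, and Euler's identity concludes. *)
Lemma null_dsyms D L : all (fun p => wwt p.2 == D.+1) L ->
  (forall n, null (dsyms n L)) -> null L.
Proof.
move=> aL nL; pose S := undup (flatten [seq p.2 | p <- L]).
have uS : uniq S by apply: undup_uniq.
have LS p : p \in L -> {subset p.2 <= S}.
  by move=> pL x xp; rewrite mem_undup; apply/flattenP; exists p.2 => //; apply: map_f.
pose R x g := \sum_(p <- L) p.1 * rmf x g p.2.
have RS x g : x \notin S -> R x g = 0.
  move=> xS; rewrite /R big_seq big1 // => p pL; rewrite /rmf.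
  rewrite (count_memPn _) ?mul0r ?mulr0 //.
  by apply: contra xS; apply: LS.
(* the derivatives along the f t^m: h t^N is a new variable, only reached from f t^m *)
have Rf m g : symf g -> R (true, m) g = 0.
  move=> sg; have [N freshN] := fresh_int S; pose y : letter := (false, N).
  have := nL (N - m) _ (symf_rm y sg); rewrite fsum_dsyms => <-.
  rewrite /R big_seq [RHS]big_seq; apply: eq_bigr => p pL.
  rewrite fsum_dsym; last exact: symf_rm.
  rewrite (sum_count _ uS (LS p pL)) /rmf; congr (_ * _).
  have yrem x : y \notin rem x p.2.
    by apply/negP => /mem_rem /LS-/(_ pL)/freshN; rewrite eqxx.
  have term x : dletter (N - m) x (rmf y g) (rem x p.2) =
      (x == (true, m))%:R * g (rem x p.2).
    rewrite /dletter /rmf; case: x => -[] j /=; last first.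
      by rewrite (count_memPn (yrem _)) mul0r mulr0 mul0r.
    rewrite (count_memPn (yrem _)) addn0 [(true, j) == _]xpair_eqE /=.
    have -> : ((false, N - m + j) == y :> letter) = (j == m).
      by rewrite /y xpair_eqE /=; apply/eqP/eqP => ?; lia.
    by case: eqP => _; rewrite ?mul1r // !mul0r.
  have [mS|mS] := boolP ((true, m) \in S); last first.
    rewrite (count_memPn _) ?mul0r; last by apply: contra mS; apply: LS.
    rewrite big_seq big1 // => x xS; rewrite term.
    by case: eqP xS mS => [-> ->|]; rewrite // mul0r mulr0.
  rewrite (bigD1_seq (true, m)) //= term eqxx mul1r big1 ?addr0 // => x /negPf nx.
  by rewrite term nx mul0r mulr0.
(* the derivatives along the h t^m: what remains is their pairing with phi *)
have Rh m g : symf g -> R (false, m) g = 0.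
  move=> sg; have [mS|/RS//] := boolP ((false, m) \in S).
  pose s := [seq x.2 | x <- S & ~~ x.1].
  have us : uniq s.
    rewrite map_inj_in_uniq ?filter_uniq // => -[a i] [b j].
    by rewrite !mem_filter /= => /andP[/negPf-> _] /andP[/negPf-> _] ->.
  apply: (@phi_nd s (fun j => R (false, j) g) us) => [n|]; last first.
    by apply/mapP; exists (false, m); rewrite ?mem_filter.
  have := nL n g sg; rewrite fsum_dsyms => sum0; apply: (@mulfI _ (- 2)).
    by rewrite oppr_eq0 pnatr_eq0.
  rewrite mulr0 -[RHS]sum0 big_map big_filter mulr_sumr.
  rewrite [RHS]big_seq (eq_bigr (fun p => \sum_(x <- S)
    p.1 * ((count_mem x p.2)%:R * dletter n x g (rem x p.2)))); last first.
    by move=> p pL; rewrite fsum_dsym // (sum_count _ uS (LS p pL)) mulr_sumr.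
  rewrite -big_seq exchange_big /= [RHS](bigID (fun x => x.1)) /=.
  rewrite [X in _ = X + _]big1 ?add0r => [|[b j] /= ->].
    apply: eq_bigr => -[b j] /= /negPf->; rewrite /R mulr_suml mulr_sumr.
    apply: eq_bigr => p _; rewrite /rmf /dletter /=; ring.
  exact: Rf (symf_cons _ sg).
have R0 x g : symf g -> R x g = 0 by case: x => -[] j; [apply: Rf | apply: Rh].
(* the identity of Euler for the weight: D + 1 times g is the sum over the letters x of
   lwt x times g at x times the derivative along x *)
move=> g sg; apply: (@mulfI _ (D.+1%:R : k)); first by rewrite pnatr_eq0.
rewrite mulr0 /fsum mulr_sumr.
transitivity (\sum_(p <- L) \sum_(x <- S) (lwt x)%:R * (p.1 * rmf x (g \o cons x) p.2)).
  rewrite big_seq [RHS]big_seq; apply: eq_bigr => p pL.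
  have /allP/(_ p pL)/eqP <- := aL; rewrite /wwt natr_sum mulr_suml.
  rewrite big_seq (eq_bigr (fun x => (lwt x)%:R * (p.1 * g (x :: rem x p.2)))).
    rewrite -big_seq (sum_count _ uS (LS p pL)); apply: eq_bigr => x _.
    by rewrite /rmf /=; ring.
  by move=> x xp; rewrite (sg _ _ (perm_to_rem xp)).
rewrite exchange_big big1 //= => x _; rewrite -mulr_sumr.
by have := R0 x _ (symf_cons x sg); rewrite /R => ->; rewrite mulr0.
Qed.

Lemma wwt_eq0 l : wwt l = 0%N -> l = [::].
Proof. by case: l => // x l; rewrite wwt_cons. Qed.

(** The symbol of an element of a proper left ideal containing J: applying
   the operators e t^n - phi(t^n) would bring any nonzero symbol down
   to a nonzero scalar. *)
Lemma symbol_null (N : A -> Prop) : left_ideal N -> (forall u, J u -> N u) ->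
  ~ N 1 -> forall D L v, all (fun p => wwt p.2 == D) L -> N v ->
  infilt D (v - wsum L) -> null L.
Proof.
move=> idN JN N1; elim=> [|D IH] L v aL Nv Fv.
  have nilL p : p \in L -> p.2 = [::].
    by move=> pL; apply/wwt_eq0/eqP; have /allP/(_ p pL) := aL.
  move/infilt0: Fv => /JN NvL; pose c := \sum_(p <- L) p.1.
  have wL : wsum L = c%:A.
    rewrite /wsum scaler_suml big_seq [RHS]big_seq; apply: eq_bigr => p pL.
    by rewrite nilL // word_nil.
  have Nc : N c%:A by rewrite -wL -(subKr v (wsum L)); apply: (lidealB idN).
  have c0 : c = 0.
    apply/eqP; apply: contra_notT N1 => cN0.
    by rewrite -[1](scalerK cN0); apply: lidealZ.
  move=> g _; rewrite /fsum big_seq.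
  rewrite (eq_bigr (fun p => p.1 * g [::])) => [|p pL]; last by rewrite nilL.
  by rewrite -big_seq -mulr_suml -/c c0 mul0r.
apply: (null_dsyms aL) => n; apply: (IH _ (e n * v - phi n *: v)).
- apply/allP => q /flattenP[_ /mapP[p pL ->]] /mapP[r rp -> /=].
  by rewrite -eqSS (eqP (allP (dsym_wt n p.2) r rp)); apply: (allP aL).
- by apply: (lidealB idN); [apply: (lidealM idN) | apply: lidealZ].
pose E u := e n * u - phi n *: u.
have EB u w : E (u - w) = E u - E w.
  by rewrite /E opprD addrACA -opprD -mulrBr -scalerBr.
apply: (@infilt_eq _ _ (E (wsum L) - wsum (dsyms n L))).
  rewrite -[e n * v - _]/(E v) opprB addrA subrK -EB; exact: infilt_e.
rewrite wsum_dsyms /E mulr_sumr scaler_sumr -!sumrB big_seq.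
apply: infilt_sum => p pL; rewrite -scalerAr scalerA mulrC -scalerA -!scalerBr.
by apply: infiltZ; have := e_word_sym n p.2; rewrite (eqP (allP aL p pL)).
Qed.

(** An element of N has zero symbol, so that its weight can be lowered until it
   lies in J. *)
Lemma proper_ideal_min (N : A -> Prop) : left_ideal N -> (forall u, J u -> N u) ->
  ~ N 1 -> forall D u, infilt D u -> N u -> J u.
Proof.
move=> idN JN N1; elim=> [|D IH] u Fu Nu; first exact: infilt0.
apply: IH => //; case: Fu => L aL JL.
pose L0 := [seq p <- L | wwt p.2 == D]; pose L1 := [seq p <- L | wwt p.2 != D].
have wL : wsum L = wsum L0 + wsum L1.
  by rewrite /wsum !big_filter [LHS](bigID (fun p => wwt p.2 == D)).
have F1 : infilt D (wsum L1).
  rewrite /wsum big_seq; apply: infilt_sum => p; rewrite mem_filter => /andP[np pL].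
  by apply/infiltZ/infilt_word; rewrite ltn_neqAle np -ltnS; apply: (allP aL).
have F0 : infilt D (u - wsum L0).
  apply: (@infilt_eq _ _ (wsum L1)) => //; apply: infiltJ.
  by rewrite -addrA -opprD -wL.
apply: infilt_eq (F0) _; apply: null_wsum; first exact: filter_all.
by apply: (symbol_null idN JN N1 (filter_all _ _) Nu F0).
Qed.
End Words.

(** * The algebra of endomorphisms of a module *)

Section Endo.
Variables (k : comNzRingType) (V : lmodType k).

Definition linp : {pred V -> V} := fun f => `[< linear f >].

Lemma linp_submod : submod_closed linp.
Proof.
split=> [|c f g /asboolP lf /asboolP lg]; apply/asboolP => a u v.
  by rewrite [RHS]addr0 scaler0.
rewrite -[LHS]/(c *: f (a *: u + v) + g (a *: u + v)).
rewrite -[RHS]/(a *: (c *: f u + g u) + (c *: f v + g v)).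
rewrite lf lg !scalerDr !scalerA mulrC -!addrA; congr (_ + _).
by rewrite addrCA.
Qed.
HB.instance Definition _ := GRing.isSubmodClosed.Build k (V -> V) linp linp_submod.

Record endo := Endo { endo_fun :> V -> V; endoP : endo_fun \in linp }.
HB.instance Definition _ := [isSub for endo_fun].
HB.instance Definition _ := [Choice of endo by <:].
HB.instance Definition _ := [SubChoice_isSubLmodule of endo by <:].

Lemma endo_linear (f : endo) : linear f.
Proof. exact/asboolP/(endoP f). Qed.
HB.instance Definition _ (f : endo) :=
  GRing.isLinear.Build k V V *:%R f (endo_linear f).

Lemma endo_eq (f g : endo) : f =1 g -> f = g.
Proof. by move=> fg; apply/val_inj/funext. Qed.

Lemma endo_one_subproof : id \in linp.
Proof. by apply/asboolP. Qed.
Definition endo_one := Endo endo_one_subproof.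

Lemma endo_mul_subproof (f g : endo) : f \o g \in linp.
Proof. by apply/asboolP => a u v; rewrite /= !linearP. Qed.
Definition endo_mul (f g : endo) := Endo (endo_mul_subproof f g).

Lemma endo_mulA : associative endo_mul. Proof. by move=> f g h; apply: endo_eq. Qed.
Lemma endo_mul1l : left_id endo_one endo_mul. Proof. by move=> f; apply: endo_eq. Qed.
Lemma endo_mul1r : right_id endo_one endo_mul. Proof. by move=> f; apply: endo_eq. Qed.
Lemma endo_mulDl : left_distributive endo_mul +%R.
Proof. by move=> f g h; apply: endo_eq. Qed.
Lemma endo_mulDr : right_distributive endo_mul +%R.
Proof. by move=> f g h; apply: endo_eq => v; apply: (raddfD f). Qed.

HB.instance Definition _ := GRing.Zmodule_isPzRing.Build endo
  endo_mulA endo_mul1l endo_mul1r endo_mulDl endo_mulDr.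

(** The phantom argument makes the ring structure nontrivial. *)
Definition nzendo (V_neq0 : exists v : V, v != 0) := endo.
Section NzEndo.
Hypothesis V_neq0 : exists v : V, v != 0.
Local Notation E := (nzendo V_neq0).
HB.instance Definition _ := GRing.PzRing.on E.
HB.instance Definition _ := GRing.Lmodule.on E.

Lemma endo_neq0 : (1 : E) != 0.
Proof.
have [v vN0] := V_neq0; apply: contra_neq vN0 => E10.
by rewrite -[v]/((1 : E) v) E10.
Qed.
HB.instance Definition _ := GRing.PzSemiRing_isNonZero.Build E endo_neq0.

Lemma endo_scaleAl (c : k) (f g : E) : c *: (f * g) = c *: f * g.
Proof. exact: endo_eq. Qed.
HB.instance Definition _ := GRing.Lmodule_isLalgebra.Build k E endo_scaleAl.
Lemma endo_scaleAr (c : k) (f g : E) : c *: (f * g) = f * (c *: g).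
Proof. by apply: endo_eq => v; rewrite -[RHS]/((f : endo) (c *: (g : endo) v)) linearZ. Qed.
HB.instance Definition _ := GRing.Lalgebra_isAlgebra.Build k E endo_scaleAr.

Lemma nzendo1E v : (1 : E) v = v. Proof. by []. Qed.
Lemma nzendoME (f g : E) v : (f * g : E) v = (f : endo) ((g : endo) v).
Proof. by []. Qed.
Lemma nzendoLE c (f g : E) v : (c *: f + g : E) v = c *: (f : endo) v + (g : endo) v.
Proof. by []. Qed.

Lemma nzendo_sumE (I : Type) (r : seq I) (c : I -> k) (F : I -> E) v :
  (\sum_(i <- r) c i *: F i : E) v = \sum_(i <- r) c i *: (F i : endo) v.
Proof.
have DE (f g : E) : (f + g) v = f v + g v by [].
have ZE a (f : E) : (a *: f) v = a *: f v by [].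
by elim: r => [|i r IH]; rewrite ?big_nil // !big_cons DE ZE IH.
Qed.
End NzEndo.
End Endo.

(** * A coinduced module containing Whittaker vectors *)

Section Coinduced.
Variables (k : numFieldType) (T : Type).
Variables (hH : int -> (T -> k^o) -> T -> k^o) (b kdot : k).

(** The values of the cocycle on (h t^m, h t^n) and (e t^m, f t^n) when K acts by
   kdot and b = (e, f), so that (h, h) = 2 b. *)
Definition coc_hh (m n : int) : k := if m + n == 0 then m%:~R * (2 * b * kdot) else 0.
Definition coc_ef (m n : int) : k := if m + n == 0 then m%:~R * (b * kdot) else 0.

Hypothesis hH_lin : forall n a G G' mu,
  hH n (a *: G + G') mu = a * hH n G mu + hH n G' mu.
Hypothesis hH_comm : forall m n G mu,
  hH m (hH n G) mu - hH n (hH m G) mu = coc_hh m n * G mu.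

(** Take a module of the Heisenberg algebra spanned by the h t^n and K, here a space
   of functions on T, and let the f t^n act on it by 0. A state is an element of the
   module coinduced from it to the affine algebra, given by its values on the words
   in the e t^n. The operators hop and fop are forced by eop, by their values on
   the empty word, and by the brackets with the e t^n. *)
Definition state := seq int -> T -> k^o.
HB.instance Definition _ := GRing.Lmodule.on state.
Implicit Types (Psi Phi : state) (m n : int) (s : seq int).

Definition eop m Psi : state := fun s => Psi (m :: s).

Fixpoint hval n s Psi : T -> k^o :=
  if s is m :: s' then fun mu => hval n s' (eop m Psi) mu - 2 * Psi (m + n :: s') mu
  else hH n (Psi [::]).
Definition hop n Psi : state := fun s => hval n s Psi.

Fixpoint fval n s Psi : T -> k^o :=
  if s is m :: s' then
    fun mu => fval n s' (eop m Psi) mu + hop (m + n) Psi s' mu + coc_ef m n * Psi s' mu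
  else fun=> 0.
Definition fop n Psi : state := fun s => fval n s Psi.

Lemma eop_lin m a Psi Phi : eop m (a *: Psi + Phi) = a *: eop m Psi + eop m Phi.
Proof. by []. Qed.

Lemma hop_lin n a Psi Phi : hop n (a *: Psi + Phi) = a *: hop n Psi + hop n Phi.
Proof.
apply/funext => s; apply/funext => mu; rewrite /hop.
rewrite -[RHS]/(a * hval n s Psi mu + hval n s Phi mu).
elim: s Psi Phi mu => [|m s IH] Psi Phi mu /=; first exact: hH_lin.
rewrite eop_lin IH -[(a *: Psi + Phi) _ _]/(a * Psi (m + n :: s) mu + Phi (m + n :: s) mu).
ring.
Qed.

Lemma hopZ n a Psi : hop n (a *: Psi) = a *: hop n Psi.
Proof.
have hop0 : hop n 0 = 0.
  by have := hop_lin n (-1) 0 0; rewrite scaler0 addr0 scaleN1r addNr.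
by have := hop_lin n a Psi 0; rewrite !addr0 hop0 addr0.
Qed.

Lemma fop_lin n a Psi Phi : fop n (a *: Psi + Phi) = a *: fop n Psi + fop n Phi.
Proof.
apply/funext => s; apply/funext => mu; rewrite /fop.
rewrite -[RHS]/(a * fval n s Psi mu + fval n s Phi mu).
elim: s Psi Phi mu => [|m s IH] Psi Phi mu /=; first by ring.
rewrite eop_lin IH hop_lin -[(a *: Psi + Phi) _ _]/(a * Psi s mu + Phi s mu).
rewrite -[(a *: hop _ Psi + _) _ _]/(a * hop (m + n) Psi s mu + hop (m + n) Phi s mu).
ring.
Qed.

Lemma eop_hop m n Psi : eop m (hop n Psi) = - 2 *: eop (m + n) Psi + hop n (eop m Psi).
Proof.
by apply/funext => s; apply/funext => mu; rewrite [LHS]addrC -mulNr.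
Qed.

Lemma eop_fop m n Psi :
  eop m (fop n Psi) = coc_ef m n *: Psi + (1 *: hop (m + n) Psi + fop n (eop m Psi)).
Proof.
apply/funext => s; apply/funext => mu; rewrite scale1r.
rewrite -[RHS]/(coc_ef m n * Psi s mu + (hop (m + n) Psi s mu + fval n s (eop m Psi) mu)).
by rewrite -[LHS]/(fval n s (eop m Psi) mu + hop (m + n) Psi s mu
  + coc_ef m n * Psi s mu); ring.
Qed.

(** Both sides of a relation between hop and fop have the same bracket with each
   e t^x by the relations proved before, so that an induction on the word reduces
   it to the empty word. *)
Lemma hop_comm m n Psi s mu :
  hop m (hop n Psi) s mu - hop n (hop m Psi) s mu = coc_hh m n * Psi s mu.
Proof.
elim: s Psi => [|x s IH] Psi; first exact: hH_comm.
have hopE p q : hop p (hop q Psi) (x :: s) mu = hop p (hop q (eop x Psi)) s mu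
    - 2 * hop p (eop (x + q) Psi) s mu - 2 * hop q (eop (x + p) Psi) s mu
    + 4 * Psi (x + p + q :: s) mu.
  rewrite -[LHS]/(hop p (eop x (hop q Psi)) s mu
    - 2 * (hop q (eop (x + p) Psi) s mu - 2 * Psi (x + p + q :: s) mu)).
  rewrite eop_hop hop_lin.
  rewrite -[(_ *: _ + _) s mu]/(- 2 * hop p (eop (x + q) Psi) s mu
     + hop p (hop q (eop x Psi)) s mu); ring.
rewrite !hopE (addrAC x n m) -[Psi (x :: s) mu]/(eop x Psi s mu) -IH; ring.
Qed.

Lemma hop_fop m n Psi s mu :
  hop m (fop n Psi) s mu = fop n (hop m Psi) s mu - 2 * fop (m + n) Psi s mu.
Proof.
elim: s Psi => [|x s IH] Psi.
  rewrite -[LHS]/(hH m 0 mu) -[fop n _ _ _]/0 -[fop _ _ _ _]/0.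
  by have := hH_lin m (-1) 0 0 mu; rewrite scaler0 addr0 mulN1r addNr mulr0 subr0.
rewrite -[LHS]/(hop m (eop x (fop n Psi)) s mu
  - 2 * (fval n s (eop (x + m) Psi) mu + hop (x + m + n) Psi s mu
         + coc_ef (x + m) n * Psi s mu)).
rewrite eop_fop !hop_lin.
rewrite -[(_ *: _ + _) s mu]/(coc_ef x n * hop m Psi s mu
   + (1 * hop m (hop (x + n) Psi) s mu + hop m (fop n (eop x Psi)) s mu)).
rewrite -[fop n _ _ mu]/(fop n (eop x (hop m Psi)) s mu
  + hop (x + n) (hop m Psi) s mu + coc_ef x n * hop m Psi s mu).
rewrite eop_hop fop_lin.
rewrite -[(_ *: _ + _) s mu]/(- 2 * fop n (eop (x + m) Psi) s mu
   + fop n (hop m (eop x Psi)) s mu).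
rewrite -[fop (m + n) _ _ mu]/(fop (m + n) (eop x Psi) s mu
  + hop (x + (m + n)) Psi s mu + coc_ef x (m + n) * Psi s mu).
have /eqP := hop_comm m (x + n) Psi s mu; rewrite subr_eq => /eqP->.
rewrite IH -[fval n s _ mu]/(fop n (eop (x + m) Psi) s mu) (addrA x m n).
have -> : coc_hh m (x + n) = 2 * coc_ef (x + m) n - 2 * coc_ef x (m + n).
  rewrite /coc_hh /coc_ef addrA (addrA x) (addrC m x); case: ifP => _; last by ring.
  by rewrite intrD; ring.
ring.
Qed.

Lemma fop_comm m n Psi s mu : fop m (fop n Psi) s mu = fop n (fop m Psi) s mu.
Proof.
elim: s Psi => [|x s IH] Psi //.
have fopE p q : fop p (fop q Psi) (x :: s) mu = fop p (fop q (eop x Psi)) s mu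
    + (fop p (hop (x + q) Psi) s mu + fop q (hop (x + p) Psi) s mu)
    - 2 * fop (x + p + q) Psi s mu
    + (coc_ef x q * fop p Psi s mu + coc_ef x p * fop q Psi s mu).
  rewrite -[LHS]/(fop p (eop x (fop q Psi)) s mu
    + hop (x + p) (fop q Psi) s mu + coc_ef x p * fop q Psi s mu).
  rewrite eop_fop !fop_lin hop_fop.
  rewrite -[(_ *: _ + _) s mu]/(coc_ef x q * fop p Psi s mu
   + (1 * fop p (hop (x + q) Psi) s mu + fop p (fop q (eop x Psi)) s mu)); ring.
rewrite !fopE IH (addrAC x n m); ring.
Qed.

(** The functions on words in the e t^n that factor through the commutative
   algebra generated by these elements. *)
Definition symmetric Psi : Prop := forall s1 x y s2,
  Psi (s1 ++ x :: y :: s2) = Psi (s1 ++ y :: x :: s2).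

Lemma eop_sym m Psi : symmetric Psi -> symmetric (eop m Psi).
Proof. by move=> sP s1 x y s2; apply: (sP (m :: s1)). Qed.

Lemma eop_comm m n Psi : symmetric Psi -> eop m (eop n Psi) = eop n (eop m Psi).
Proof. by move=> sP; apply/funext => s; apply: (sP [::]). Qed.

Lemma hop_sym n Psi : symmetric Psi -> symmetric (hop n Psi).
Proof.
move=> sP s1 x y s2; apply/funext => mu; elim: s1 Psi sP => [|z s1 IH] Psi sP.
  have hopE u v : hop n Psi (u :: v :: s2) mu =
      hop n (eop v (eop u Psi)) s2 mu - 2 * Psi [:: u, v + n & s2] mu
       - 2 * Psi [:: u + n, v & s2] mu by [].
  rewrite !cat0s !hopE eop_comm // (sP [::] x (y + n)) (sP [::] (x + n) y) /=; ring.
rewrite -[LHS]/(hop n (eop z Psi) (s1 ++ [:: x, y & s2]) mu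
   - 2 * Psi ((z + n) :: s1 ++ [:: x, y & s2]) mu).
rewrite IH; last exact: eop_sym.
by rewrite (sP (z + n :: s1)).
Qed.

Lemma fop_sym n Psi : symmetric Psi -> symmetric (fop n Psi).
Proof.
move=> sP s1 x y s2; apply/funext => mu; elim: s1 Psi sP => [|z s1 IH] Psi sP.
  have fopE u v : fop n Psi (u :: v :: s2) mu =
      fop n (eop v (eop u Psi)) s2 mu
      + (hop (u + n) (eop v Psi) s2 mu + hop (v + n) (eop u Psi) s2 mu)
      - 2 * Psi (v + (u + n) :: s2) mu
      + (coc_ef u n * Psi (v :: s2) mu + coc_ef v n * Psi (u :: s2) mu).
    rewrite -[LHS]/(fop n (eop v (eop u Psi)) s2 mu
      + hop (v + n) (eop u Psi) s2 mu + coc_ef v n * Psi (u :: s2) mu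
      + (hop (u + n) (eop v Psi) s2 mu - 2 * Psi (v + (u + n) :: s2) mu)
      + coc_ef u n * Psi (v :: s2) mu); ring.
  rewrite !cat0s !fopE eop_comm // (addrCA x); ring.
rewrite -[LHS]/(fop n (eop z Psi) (s1 ++ [:: x, y & s2]) mu
   + hop (z + n) Psi (s1 ++ [:: x, y & s2]) mu
   + coc_ef z n * Psi (s1 ++ [:: x, y & s2]) mu).
rewrite IH; last exact: eop_sym.
by rewrite (hop_sym _ sP) sP.
Qed.

Definition symp : {pred state} := fun Psi => `[< symmetric Psi >].
Lemma symp_submod : submod_closed symp.
Proof.
split=> [|a Psi Phi /asboolP sP /asboolP sQ]; apply/asboolP => // s1 x y s2.
by rewrite -[LHS]/(a *: Psi _ + Phi _) sP sQ.
Qed.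
HB.instance Definition _ := GRing.isSubmodClosed.Build k state symp symp_submod.

Record coind := Coind { coind_val :> state; coindP : coind_val \in symp }.
HB.instance Definition _ := [isSub for coind_val].
HB.instance Definition _ := [Choice of coind by <:].
HB.instance Definition _ := [SubChoice_isSubLmodule of coind by <:].

Lemma coind_sym (v : coind) : symmetric v. Proof. exact/asboolP/(coindP v). Qed.
Lemma coind_eq (u v : coind) :
  (forall s mu, coind_val u s mu = coind_val v s mu) -> u = v.
Proof. by move=> uv; apply/val_inj/funext => s; apply/funext => mu; apply: uv. Qed.

Lemma coind_sumE (I : Type) (r : seq I) (c : I -> k) (F : I -> coind) s mu :
  coind_val (\sum_(i <- r) c i *: F i) s mu = \sum_(i <- r) c i * coind_val (F i) s mu.
Proof.
have DE (u v : coind) : coind_val (u + v) s mu = coind_val u s mu + coind_val v s mu by [].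
have ZE a (v : coind) : coind_val (a *: v) s mu = a * coind_val v s mu by [].
by elim: r => [|i r IH]; rewrite ?big_nil // !big_cons DE ZE IH.
Qed.

Lemma eX_subproof m (v : coind) : eop m v \in symp.
Proof. exact/asboolP/eop_sym/coind_sym. Qed.
Lemma hX_subproof m (v : coind) : hop m v \in symp.
Proof. exact/asboolP/hop_sym/coind_sym. Qed.
Lemma fX_subproof m (v : coind) : fop m v \in symp.
Proof. exact/asboolP/fop_sym/coind_sym. Qed.

Lemma eX_lin m : (fun v => Coind (eX_subproof m v)) \in @linp k coind.
Proof.
apply/asboolP => a u v; apply: coind_eq => s mu.
exact: (congr1 (fun F : state => F s mu)
  (eop_lin m a (coind_val u) (coind_val v))).
Qed.
Lemma hX_lin m : (fun v => Coind (hX_subproof m v)) \in @linp k coind.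
Proof.
apply/asboolP => a u v; apply: coind_eq => s mu.
exact: (congr1 (fun F : state => F s mu)
  (hop_lin m a (coind_val u) (coind_val v))).
Qed.
Lemma fX_lin m : (fun v => Coind (fX_subproof m v)) \in @linp k coind.
Proof.
apply/asboolP => a u v; apply: coind_eq => s mu.
exact: (congr1 (fun F : state => F s mu)
  (fop_lin m a (coind_val u) (coind_val v))).
Qed.

Hypothesis coind_neq0 : exists v : coind, v != 0.
Definition coindE := nzendo coind_neq0.
HB.instance Definition _ := GRing.Algebra.on coindE.

Definition eX m : coindE := Endo (eX_lin m).
Definition hX m : coindE := Endo (hX_lin m).
Definition fX m : coindE := Endo (fX_lin m).

Lemma eX_eX m n : eX m * eX n - eX n * eX m = 0.
Proof.
apply/eqP; rewrite subr_eq0; apply/eqP/endo_eq => v; apply: val_inj.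
exact/eop_comm/coind_sym.
Qed.
Lemma hX_hX m n : hX m * hX n - hX n * hX m = coc_hh m n *: 1.
Proof. by apply: endo_eq => v; apply: coind_eq => s mu; apply: hop_comm. Qed.
Lemma fX_fX m n : fX m * fX n - fX n * fX m = 0.
Proof.
apply/eqP; rewrite subr_eq0; apply/eqP/endo_eq => v; apply: coind_eq => s mu.
exact: fop_comm.
Qed.
Lemma eX_hX m n : eX m * hX n - hX n * eX m = - 2 *: eX (m + n).
Proof.
apply/eqP; rewrite subr_eq; apply/eqP/endo_eq => v; apply: val_inj.
exact: eop_hop.
Qed.
Lemma hX_fX m n : hX m * fX n - fX n * hX m = - 2 *: fX (m + n).
Proof.
apply/eqP; rewrite subr_eq; apply/eqP/endo_eq => v; apply: coind_eq => s mu.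
rewrite -[RHS]/(- 2 * fop (m + n) (coind_val v) s mu
  + fop n (hop m (coind_val v)) s mu).
rewrite -[LHS]/(hop m (fop n (coind_val v)) s mu) hop_fop; ring.
Qed.
Lemma eX_fX m n : eX m * fX n - fX n * eX m = hX (m + n) + coc_ef m n *: 1.
Proof.
apply/eqP; rewrite subr_eq; apply/eqP/endo_eq => v; apply: coind_eq => s mu.
rewrite -[RHS]/(hop (m + n) (coind_val v) s mu + coc_ef m n * coind_val v s mu
  + fop n (eop m (coind_val v)) s mu).
rewrite -[LHS]/(fop n (eop m (coind_val v)) s mu
  + hop (m + n) (coind_val v) s mu + coc_ef m n * coind_val v s mu); ring.
Qed.
End Coinduced.

(** * Representations of the affine algebra from their generating operators *)

Section SL2Form.
Variables (k : numFieldType) (B : inv_form (sl2 k)).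

Lemma sl2_decomp (x : sl2 k) : x = (x : 'M_2) 0 1 *: sl2_e +
  ((x : 'M_2) 1 0 *: sl2_f + (x : 'M_2) 0 0 *: sl2_h).
Proof.
have trx : (x : 'M_2) 1 1 = - (x : 'M_2) 0 0.
  apply/eqP; rewrite -addr_eq0 addrC; have := sl2_mxP x.
  rewrite unfold_in /mxtrace big_ord_recl big_ord1.
  by rewrite (_ : lift ord0 ord0 = 1) //; apply: val_inj.
apply: val_inj; apply/matrixP => i j; rewrite /= !mxE.
have ix (l : 'I_2) : (l == 0) || (l == 1) by case: l => -[|[|]].
case/orP: (ix i) => /eqP->; case/orP: (ix j) => /eqP->; rewrite ?trx //=; ring.
Qed.

Lemma sl2_ind (P : sl2 k -> Prop) :
  (forall c x y, P x -> P y -> P (c *: x + y)) ->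
  P sl2_e -> P sl2_f -> P sl2_h -> forall x, P x.
Proof.
move=> PD Pe Pf Ph x; rewrite [x]sl2_decomp; do 2!apply: (PD _ _ _) => //.
have P0 : P 0 by rewrite -(addNr sl2_e) -scaleN1r; apply: PD.
by rewrite -[_ *: _]addr0; apply: PD.
Qed.

Lemma form_hh : B sl2_h sl2_h = 2 * B sl2_e sl2_f.
Proof.
have := inv_form_lie B sl2_e sl2_f sl2_h; rewrite lie_ef => ->.
by rewrite lieC lie_hf -scaleNr opprK; rewrite Defs.formZr.
Qed.

Lemma form_ff : B sl2_f sl2_f = 0.
Proof.
have := inv_form_lie B sl2_h sl2_f sl2_f; rewrite lie_hf liexx Defs.form0r Defs.formZl.
by move/eqP; rewrite mulf_eq0 oppr_eq0 pnatr_eq0 => /eqP.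
Qed.

Lemma form_he : B sl2_h sl2_e = 0.
Proof.
have := inv_form_lie B sl2_h sl2_h sl2_e; rewrite liexx Defs.form0l lie_he Defs.formZr.
by move/esym/eqP; rewrite mulf_eq0 pnatr_eq0 => /eqP.
Qed.

Lemma form_hf : B sl2_h sl2_f = 0.
Proof.
have := inv_form_lie B sl2_h sl2_h sl2_f; rewrite liexx Defs.form0l lie_hf Defs.formZr.
by move/esym/eqP; rewrite mulf_eq0 oppr_eq0 pnatr_eq0 => /eqP.
Qed.
End SL2Form.

Section AffineRep.
Variables (k : numFieldType) (B : inv_form (sl2 k)) (A : algType k).
Variables (e h f : int -> A) (kdot : k).
Local Notation b := (B sl2_e sl2_f).

Let comm (x y : A) := x * y - y * x.
Hypothesis ee : forall m n, e m * e n - e n * e m = 0.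
Hypothesis hh : forall m n, h m * h n - h n * h m = coc_hh b kdot m n *: 1.
Hypothesis ff : forall m n, f m * f n - f n * f m = 0.
Hypothesis eh : forall m n, e m * h n - h n * e m = - 2 *: e (m + n).
Hypothesis hf : forall m n, h m * f n - f n * h m = - 2 *: f (m + n).
Hypothesis ef : forall m n, e m * f n - f n * e m = h (m + n) + coc_ef b kdot m n *: 1.

(** The operator of x t^n. *)
Definition loop_op (n : int) (x : sl2 k) : A :=
  (x : 'M_2) 0 1 *: e n + ((x : 'M_2) 1 0 *: f n + (x : 'M_2) 0 0 *: h n).

Lemma loop_op_lin n : linear (loop_op n).
Proof.
move=> c x y; rewrite /loop_op /= !mxE !scalerDr !scalerDl !scalerA.
by rewrite (addrACA _ (_ *: f n)) (addrACA _ (_ *: e n)).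
Qed.

Lemma loop_op_e n : loop_op n sl2_e = e n.
Proof. by rewrite /loop_op !mxE /= !scale0r scale1r !addr0. Qed.
Lemma loop_op_f n : loop_op n sl2_f = f n.
Proof. by rewrite /loop_op !mxE /= !scale0r scale1r addr0 add0r. Qed.
Lemma loop_op_h n : loop_op n sl2_h = h n.
Proof. by rewrite /loop_op !mxE /= !subr0 !scale0r scale1r !add0r. Qed.

Lemma loop_opZ n c x : loop_op n (c *: x) = c *: loop_op n x.
Proof.
have L0 : loop_op n 0 = 0 by rewrite /loop_op !mxE !scale0r !addr0.
by have := loop_op_lin n c x 0; rewrite addr0 L0 addr0.
Qed.

Let cB (m n : int) (x y : sl2 k) : k := if m + n == 0 then m%:~R * B x y else 0.

Let commDl c x y z : comm (c *: x + y) z = c *: comm x z + comm y z.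
Proof.
rewrite /comm mulrDl mulrDr opprD addrACA -scalerAl -scalerAr.
by rewrite -scalerBr.
Qed.
Let commDr c x y z : comm z (c *: x + y) = c *: comm z x + comm z y.
Proof.
rewrite /comm mulrDl mulrDr opprD addrACA -scalerAl -scalerAr.
by rewrite -scalerBr.
Qed.
Let commC x y : comm x y = - comm y x. Proof. by rewrite /comm opprB. Qed.

Let cBDl m n c x y z : cB m n (c *: x + y) z = c * cB m n x z + cB m n y z.
Proof.
rewrite /cB; case: ifP => _; last by rewrite mulr0 addr0.
by rewrite (inv_form_linear B z c x y) /= mulrDr mulrCA.
Qed.
Let cBDr m n c x y z : cB m n z (c *: x + y) = c * cB m n z x + cB m n z y.
Proof.
rewrite /cB; case: ifP => _; last by rewrite mulr0 addr0.
rewrite inv_form_sym (inv_form_linear B z c x y) /= mulrDr mulrCA.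
by rewrite !(inv_form_sym B z).
Qed.

Let comb_lin p c u v w (d d1 d2 : k) : w = c *: u + v -> d = c * d1 + d2 ->
  loop_op p w + (kdot * d)%:A =
  c *: (loop_op p u + (kdot * d1)%:A) + (loop_op p v + (kdot * d2)%:A) :> A.
Proof.
move=> -> ->; rewrite loop_op_lin; move: (loop_op p u) (loop_op p v) => a a'.
by rewrite mulrDr mulrCA scalerDl -[(c * _)%:A]scalerA [c *: (_ + _)]scalerDr addrACA.
Qed.

Let bracket m n x y := comm (loop_op m x) (loop_op n y) =
  loop_op (m + n) (lie x y) + (kdot * cB m n x y)%:A.

Let bracketC m n x y : bracket m n x y -> bracket n m y x.
Proof.
rewrite /bracket [in X in _ -> X]commC => ->; rewrite opprD [in RHS]lieC (addrC n).
rewrite -[- lie x y]scaleN1r loop_opZ scaleN1r; congr (_ + _).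
rewrite -scaleNr; congr (_ *: _); rewrite /cB (addrC n) inv_form_sym.
case: eqP => [/eqP|_]; last by rewrite mulr0 oppr0.
by rewrite addr_eq0 => /eqP->; rewrite mulrNz; ring.
Qed.

(** Both sides are bilinear and antisymmetric in the pairs (x, m) and (y, n), which
   leaves six brackets of basis vectors. *)
Lemma loop_op_lie m n x y : comm (loop_op m x) (loop_op n y) =
  loop_op (m + n) (lie x y) + (kdot * cB m n x y)%:A.
Proof.
have Pl : forall y, bracket m n sl2_e y -> bracket m n sl2_f y ->
    bracket m n sl2_h y -> forall x, bracket m n x y.
  move=> {x}y Pe Pf Ph; apply: sl2_ind => // c u v; rewrite /bracket => IHu IHv.
  rewrite loop_op_lin commDl IHu IHv; apply/esym/comb_lin; last exact: cBDl.
  by rewrite lieDl lieZl.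
have Pr : forall x, bracket m n x sl2_e -> bracket m n x sl2_f ->
    bracket m n x sl2_h -> forall y, bracket m n x y.
  move=> {y}x Pe Pf Ph; apply: sl2_ind => // c u v; rewrite /bracket => IHu IHv.
  rewrite loop_op_lin commDr IHu IHv; apply/esym/comb_lin; last exact: cBDr.
  by rewrite lieDr lieZr.
have cB0 p q u v : B u v = 0 -> (kdot * cB p q u v)%:A = 0 :> A.
  by rewrite /cB => ->; rewrite mulr0 if_same mulr0 scale0r.
have L0 p : loop_op p 0 = 0 by rewrite -(scale0r sl2_e) loop_opZ scale0r.
have Bef p q : bracket p q sl2_e sl2_f.
  rewrite /bracket loop_op_e loop_op_f lie_ef loop_op_h [LHS]ef /cB /coc_ef.
  by congr (_ + _ *: _); case: ifP => _; rewrite ?mulr0 //; ring.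
have Bhe p q : bracket p q sl2_h sl2_e.
  apply: bracketC; rewrite /bracket loop_op_e loop_op_h cB0; last first.
    by rewrite inv_form_sym form_he.
  by rewrite addr0 lieC lie_he -scaleNr loop_opZ loop_op_e; apply: eh.
have Bhf p q : bracket p q sl2_h sl2_f.
  rewrite /bracket loop_op_f loop_op_h cB0 ?form_hf //.
  by rewrite addr0 lie_hf loop_opZ loop_op_f; apply: hf.
apply: Pl; apply: Pr => //; try by apply: bracketC.
- by rewrite /bracket liexx L0 !loop_op_e cB0 ?form_ee // addr0; apply: ee.
- by rewrite /bracket liexx L0 !loop_op_f cB0 ?form_ff // addr0; apply: ff.
rewrite /bracket liexx L0 !loop_op_h [LHS]hh add0r /cB /coc_hh form_hh.
by congr (_ *: _); case: ifP => _; rewrite ?mulr0 //; ring.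
Qed.

Definition affine_op (u : affine B) : A := msum loop_op u.1 + (kdot * u.2)%:A.

Let loop_opB n : {morph loop_op n : x y / x - y}.
Proof. by move=> x y; rewrite addrC -scaleN1r loop_op_lin scaleN1r addrC. Qed.

Let msum_tmon n x : msum loop_op (tmon x n) = loop_op n x.
Proof. exact: msumU. Qed.

Lemma msum_loop_opZ c (a : laurent (sl2 k)) : msum loop_op (c *: a) = c *: msum loop_op a.
Proof.
elim/laurent_ind: a => [|a a' IH IH'|x m].
- by rewrite scaler0 msum0 scaler0.
- by rewrite scalerDr !msumD // scalerDr IH IH'.
by rewrite tmonZ !msum_tmon loop_opZ.
Qed.

Lemma affine_op_linear : linear affine_op.
Proof.
move=> c u v; rewrite /affine_op /= msumD // msum_loop_opZ scalerDr addrACA.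
by rewrite mulrDr scalerDl scalerA; congr (_ + (_ *: _ + _)); rewrite mulrCA.
Qed.

Lemma affine_op_lie u v : affine_op (lie u v) =
  affine_op u * affine_op v - affine_op v * affine_op u.
Proof.
have comm1 x : comm 1 x = 0 by rewrite /comm mul1r mulr1 subrr.
have scal x y c d : comm (x + c%:A) (y + d%:A) = comm x y.
  rewrite addrC commDl comm1 scaler0 add0r addrC commDr.
  by rewrite [comm x 1]commC comm1 oppr0 scaler0 add0r.
rewrite -[RHS]/(comm (affine_op u) (affine_op v)) scal /affine_op /=.
elim/laurent_ind: (u.1) => [|a a' IH IH'|x m].
- by rewrite loop_lie0l cocycle0l !msum0 mulr0 scale0r addr0 /comm mul0r mulr0 subrr.
- rewrite loop_lieDl cocycleDl !msumD // mulrDr scalerDl addrACA IH IH'.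
  by rewrite -[msum _ a in RHS]scale1r commDl scale1r.
elim/laurent_ind: (v.1) => [|b b' IH IH'|y n].
- by rewrite loop_lie0r cocycle0r !msum0 mulr0 scale0r addr0 /comm mul0r mulr0 subrr.
- rewrite loop_lieDr cocycleDr !msumD // mulrDr scalerDl addrACA IH IH'.
  by rewrite -[msum _ b in RHS]scale1r commDr scale1r.
by rewrite loop_lie_tmon cocycle_tmon !msum_tmon loop_op_lie.
Qed.

Definition affine_rep : lie_rep (affine B) A := LieRep affine_op_linear affine_op_lie.

Lemma affine_rep_tmon x n : affine_rep (tmon x n, 0) = loop_op n x.
Proof. by rewrite /= /affine_op /= mulr0 scale0r addr0 msum_tmon. Qed.
Lemma affine_rep_central : affine_rep (0, 1) = kdot%:A.
Proof. by rewrite /= /affine_op /= msum0 add0r mulr1. Qed.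
End AffineRep.

(** * A Heisenberg module with eigenvectors *)

Section Heisenberg.
Variables (k : numFieldType) (b kdot : k).
Implicit Types (mu : nat -> nat) (G : (nat -> nat) -> k^o) (n : int).

Definition hincr (j : nat) mu : nat -> nat := fun i => (mu i + (i == j))%N.
Definition hdecr (j : nat) mu : nat -> nat := fun i => (mu i - (i == j))%N.

(** In the dual of the ring of polynomials in variables x_j, a functional being given
   by its values G mu on the monomials: h t^(- j) and h t^j, for j > 0, are the
   transposes of x_j and of a multiple of d/dx_j, and h t^0 acts by 0. *)
Definition heis n G mu : k :=
  if n < 0 then G (hincr (absz n) mu)
  else - (n%:~R * (2 * b * kdot)) * (mu (absz n))%:R * G (hdecr (absz n) mu).

Lemma heis_lin n a G G' mu :
  heis n (a *: G + G') mu = a * heis n G mu + heis n G' mu.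
Proof.
by rewrite /heis; case: ifP => // _; rewrite -[(_ + _) _]/(a * G _ + G' _); ring.
Qed.

Lemma heis_comm m n G mu :
  heis m (heis n G) mu - heis n (heis m G) mu = coc_hh b kdot m n * G mu.
Proof.
have incrC i j : hincr i (hincr j mu) = hincr j (hincr i mu).
  by apply/funext => l; rewrite /hincr addnAC.
have decrC i j : hdecr i (hdecr j mu) = hdecr j (hdecr i mu).
  by apply/funext => l; rewrite /hdecr subnAC.
have incrK j : hdecr j (hincr j mu) = mu.
  by apply/funext => l; rewrite /hdecr /hincr addnK.
have decrK j : (0 < mu j)%N -> hincr j (hdecr j mu) = mu.
  move=> mu0; apply/funext => l; rewrite /hdecr /hincr.
  by case: eqP => [->|_]; rewrite ?subn1 ?addn1 ?prednK // subn0 addn0.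
have incr_decr i j : i != j -> hincr i (hdecr j mu) = hdecr j (hincr i mu).
  move=> ij; apply/funext => l; rewrite /hdecr /hincr.
  by have [->|_] := eqVneq l i; rewrite ?(negPf ij) ?subn0 // !addn0.
have mixed (p q : int) : p < 0 -> ~~ (q < 0) ->
    heis q (heis p G) mu - heis p (heis q G) mu = coc_hh b kdot q p * G mu.
  move=> p0 q0; rewrite /heis p0 (negPf q0) /coc_hh.
  have [qp|qp] := eqVneq (q + p) 0.
    have -> : absz p = absz q by lia.
    rewrite incrK /hincr eqxx natrD -[true%:R]/(1 : k).
    have [->|] := posnP (mu (absz q)); first by ring.
    by move=> /decrK; rewrite /hincr => ->; ring.
  have npq : absz q != absz p by lia.
  rewrite -incr_decr 1?eq_sym // [in X in _ - X]/hincr (negPf npq) addn0 mul0r.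
  exact: subrr.
case: (boolP (m < 0)) (boolP (n < 0)) => [m0|m0] [n0|n0].
- rewrite /heis m0 n0 incrC subrr /coc_hh ifF ?mul0r //; lia.
- have -> : coc_hh b kdot m n = - coc_hh b kdot n m.
    rewrite /coc_hh (addrC n); case: eqP => [/eqP|_]; last by rewrite oppr0.
    by rewrite addr_eq0 => /eqP->; rewrite mulrNz mulNr.
  by rewrite mulNr -(mixed m n) // opprB.
- exact: mixed.
rewrite /heis (negPf m0) (negPf n0) decrC.
have [<-|mn] := eqVneq m n.
  rewrite subrr /coc_hh; case: eqP => [/eqP|_]; last by rewrite mul0r.
  by rewrite -mulr2n mulrn_eq0 /= => /eqP->; rewrite !mul0r.
have nmn : absz n != absz m by lia.
rewrite /hdecr (negPf nmn) eq_sym (negPf nmn) !subn0 /coc_hh ifF ?mul0r; last by lia.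
ring.
Qed.

(** The evaluation of polynomials at the point a, on which the shifts act by scalars.
   The exponents mu may have infinite support, hence the truncation at J. *)
Definition heis_eigen (J : nat) (a : nat -> k) : (nat -> nat) -> k^o :=
  fun mu => \prod_(j < J) a j ^+ mu j.

Lemma heis_eigenE J a j : (j < J)%N -> (0 < j)%N ->
  heis (- j%:Z) (heis_eigen J a) = a j *: heis_eigen J a.
Proof.
move=> jJ j0; apply/funext => mu; rewrite /heis oppr_lt0 ltz_nat j0 abszN absz_nat.
rewrite -[RHS]/(a j * \prod_(i < J) a i ^+ mu i) /heis_eigen.
rewrite (bigD1 (Ordinal jJ)) //= [X in _ = _ * X](bigD1 (Ordinal jJ)) //= mulrA.
rewrite /hincr eqxx addn1 exprS; congr (_ * _); apply: eq_bigr => i ij.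
by rewrite -[j]/(nat_of_ord (Ordinal jJ)) (inj_eq val_inj) (negPf ij) addn0.
Qed.
End Heisenberg.

(** * Whittaker vectors in the coinduced module *)

Section WhittakerVectors.
Variables (k : numFieldType) (B : inv_form (sl2 k)) (kdot : k) (phi : int -> k).
Local Notation b := (B sl2_e sl2_f).
Local Notation T := (nat -> nat).
Local Notation X := (coind k T).

(** A multiplicative function of the word, with a Heisenberg eigenvector as its
   value on the empty word. *)
Definition whit_state (J : nat) (a : nat -> k) : state k T :=
  fun s mu => (\prod_(m <- s) phi m) * heis_eigen J a mu.

Lemma whit_state_subproof J a : whit_state J a \in @symp k T.
Proof.
apply/asboolP => s1 x y s2; apply/funext => mu; rewrite /whit_state !big_cat /= !big_cons.
by rewrite (mulrCA (phi x)).
Qed.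
Definition whit_coind J a : X := Coind (whit_state_subproof J a).

Lemma whit_coind_neq0 J a : whit_coind J a != 0.
Proof.
apply/eqP => /(congr1 (fun v : X => coind_val v [::] (fun=> 0%N))).
rewrite /= /whit_state big_nil mul1r /heis_eigen big1 => [|i _]; last by rewrite expr0.
by move/eqP; rewrite oner_eq0.
Qed.

Lemma coind_neq0 : exists v : X, v != 0.
Proof. by exists (whit_coind 0 (fun=> 0)); apply: whit_coind_neq0. Qed.

Definition coind_rep : lie_rep (affine B) (coindE coind_neq0) :=
  affine_rep (B := B) (kdot := kdot) (eX_eX coind_neq0)
    (hX_hX (heis_lin b kdot) (heis_comm b kdot) coind_neq0)
    (fX_fX (heis_lin b kdot) (heis_comm b kdot) coind_neq0)
    (eX_hX (heis_lin b kdot) coind_neq0)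
    (hX_fX (heis_lin b kdot) (heis_comm b kdot) coind_neq0)
    (eX_fX b kdot (heis_lin b kdot) coind_neq0).

Lemma coind_rep_e n J a :
  (coind_rep (tmon sl2_e n, 0) : endo _) (whit_coind J a) = phi n *: whit_coind J a.
Proof.
rewrite affine_rep_tmon loop_op_e; apply: coind_eq => s mu.
rewrite -[LHS]/(whit_state J a (n :: s) mu) /whit_state big_cons.
by rewrite -[RHS]/(phi n * (_ * heis_eigen J a mu)) mulrA.
Qed.

Lemma coind_rep_central J a :
  (coind_rep (0, 1) : endo _) (whit_coind J a) = kdot *: whit_coind J a.
Proof. by rewrite affine_rep_central. Qed.

(** The element h (x) t^(- size P) P; it only involves negative powers of t, which act
   on the Heisenberg module by shifts. *)
Definition affine_hP (P : {poly k}) : affine B :=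
  (\sum_(i < size P) tmon (P`_i *: sl2_h) (i%:Z - (size P)%:Z), 0).

(** When phi vanishes on the multiples of P, the brackets of h (x) t^(- size P) P
   with the e t^n contribute nothing, and this element acts as on the Heisenberg
   eigenvector. *)
Lemma coind_rep_hP (P : {poly k}) (a : nat -> k) :
  (forall n, pact P phi n = 0) ->
  (coind_rep (affine_hP P) : endo _) (whit_coind (size P).+1 a) =
    (\sum_(i < size P) P`_i * a (size P - i)%N) *: whit_coind (size P).+1 a.
Proof.
move=> Pphi; set J := size P; set c := \sum_(i < J) _.
pose hopP (Psi : state k T) s mu :=
  \sum_(i < J) P`_i * hop (heis b kdot) (i%:Z - J%:Z) Psi s mu.
have main s mu : hopP (whit_state J.+1 a) s mu = c * whit_state J.+1 a s mu.
  elim: s => [|m s IH].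
    have state_nil : whit_state J.+1 a [::] = heis_eigen J.+1 a.
      by apply/funext => nu; rewrite /whit_state big_nil mul1r.
    rewrite /c mulr_suml; apply: eq_bigr => i _; rewrite -mulrA; congr (_ * _).
    rewrite state_nil -[LHS]/(heis b kdot (i%:Z - J%:Z) (whit_state J.+1 a [::]) mu) state_nil.
    have -> : i%:Z - J%:Z = - (J - i)%N%:Z by have := ltn_ord i; lia.
    by rewrite heis_eigenE //; have := ltn_ord i; lia.
  have eop_state : eop m (whit_state J.+1 a) = phi m *: whit_state J.+1 a.
    apply/funext => t; apply/funext => nu.
    by rewrite /eop /whit_state big_cons -mulrA.
  have hopS n : hop (heis b kdot) n (whit_state J.+1 a) (m :: s) mu =
      phi m * hop (heis b kdot) n (whit_state J.+1 a) s mu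
      - 2 * whit_state J.+1 a (m + n :: s) mu.
    rewrite -[LHS]/(hop (heis b kdot) n (eop m (whit_state J.+1 a)) s mu
      - 2 * whit_state J.+1 a (m + n :: s) mu).
    by rewrite eop_state (hopZ (heis_lin b kdot)).
  rewrite /hopP (eq_bigr (fun i : 'I_J =>
    phi m * (P`_i * hop (heis b kdot) (i%:Z - J%:Z) (whit_state J.+1 a) s mu) -
    2 * whit_state J.+1 a s mu * (P`_i * phi (m - J%:Z + i%:Z)))); last first.
    move=> i _; rewrite hopS /whit_state big_cons (addrA m) addrAC; ring.
  rewrite sumrB -!mulr_sumr -[X in _ * X - _]/(hopP (whit_state J.+1 a) s mu) IH.
  have := Pphi (m - J%:Z); rewrite /pact -/J => ->.
  rewrite mulr0 subr0 /whit_state big_cons; ring.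
have repE : coind_rep (affine_hP P) =
    \sum_(i < J) P`_i *: hX (heis_lin b kdot) coind_neq0 (i%:Z - J%:Z).
  rewrite /= /affine_op /= mulr0 scale0r addr0.
  have opB n : {morph loop_op (eX coind_neq0) (hX (heis_lin b kdot) coind_neq0)
     (fX b kdot (heis_lin b kdot) coind_neq0) n : x y / x - y}.
    by move=> x y; rewrite addrC -scaleN1r loop_op_lin scaleN1r addrC.
  rewrite (big_morph _ (msumD opB) (msum0 _)); apply: eq_bigr => i _.
  by rewrite msumU // loop_opZ loop_op_h.
rewrite repE; apply: coind_eq => s mu.
rewrite -[RHS]/(c * whit_state J.+1 a s mu) -main /hopP.
by rewrite nzendo_sumE coind_sumE.
Qed.
End WhittakerVectors.

(** * The universal Whittaker module *)

Lemma uea_gen_ind (k : comNzRingType) (g : lieAlgType k) (P : uea g -> Prop) :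
  P 1 -> (forall c u v, P u -> P v -> P (c *: u + v)) ->
  (forall x u, P u -> P (uea_gen x * u)) -> forall u, P u.
Proof.
move=> P1 PD PM; have P0 : P 0 by rewrite -(addNr 1) -scaleN1r; apply: PD.
elim/uea_ind => a; elim/malg_ind: a => [|a b Pa Pb|m c]; first by rewrite uea_pi0.
  by rewrite uea_piD -[uea_pi a]scale1r; apply: PD.
have -> : << c *g m >> = c *: (<< m >> : free_alg g).
  by apply/malgP => m'; rewrite mcoeffZ !mcoeffU mulr_natr.
rewrite uea_piZ -[_ *: _]addr0; apply: PD => //.
case: m => s; elim: s => [|x s IH].
  by rewrite (_ : FMonom [::] = mone) //; apply/val_inj/esym/fm1.
rewrite (_ : FMonom (x :: s) = mmul (fmu x) (FMonom s)); last first.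
  by apply/val_inj; rewrite /= [RHS]fmM fmU.
have -> : << mmul (fmu x) (FMonom s) >> = free_gen x * (<< FMonom s >> : free_alg g).
  by rewrite malgM_def fgmulUU mulr1.
by rewrite uea_piM; apply: PM.
Qed.

Lemma annihilator_ideal (R : nzRingType) (M : lmodType R) (m : M) :
  left_ideal (fun u : R => u *: m = 0).
Proof.
split=> [|u v um vm|a u um]; first by rewrite scale0r.
  by rewrite scalerBl um vm subrr.
by rewrite -scalerA um scaler0.
Qed.

Lemma annihilator_sub (R : nzRingType) (M : lmodType R) (m : M) (u v : R) :
  u *: m = v *: m -> (u - v) *: m = 0.
Proof. by rewrite scalerBl => ->; rewrite subrr. Qed.

(** The submodules of a cyclic module R w correspond to the left ideals of R that
   contain the annihilator of w. *)
Lemma cyclic_irreducible (R : nzRingType) (M : lmodType R) (w : M) :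
  (forall m, exists r : R, m = r *: w) ->
  (forall I : R -> Prop, left_ideal I -> (forall u, u *: w = 0 -> I u) ->
    ~ I 1 -> forall u, I u -> u *: w = 0) ->
  forall N : {pred M}, submod_closed N ->
    (forall m, m \in N -> m = 0) \/ (forall m, m \in N).
Proof.
move=> cyc maxw N [N0 NL]; pose I (u : R) : Prop := u *: w \in N.
have NZ (a : R) m : m \in N -> a *: m \in N.
  by move=> mN; rewrite -[_ *: m]addr0; apply: NL.
have idI : left_ideal I.
  split=> [|u v Iu Iv|a u Iu]; rewrite /I.
  - by rewrite scale0r.
  - by rewrite scalerBl -scaleN1r addrC; apply: NL.
  by rewrite -scalerA; apply: NZ.
have wI u : u *: w = 0 -> I u by rewrite /I => ->.
have [I1|I1] := pselect (I 1); [right=> m | left=> m].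
  by have [r ->] := cyc m; apply: NZ; move: I1; rewrite /I scale1r.
have [r ->] := cyc m => Ir; exact: (maxw I idI wI I1 r Ir).
Qed.

Section Whit.
Variables (k : numFieldType) (B : inv_form (sl2 k)).
Variables (phi : {scalar (laurent k^o)}) (kdot : k).
Local Notation W := (whittaker B phi kdot).
Local Notation L := (affine B).
Local Notation b := (B sl2_e sl2_f).
Local Notation w := (whit_vec B phi kdot).

Let ph (n : int) : k := phi (tmon (1 : k^o) n).
Let ge (n : int) : uea L := uea_gen ((tmon sl2_e n, 0) : L).
Let gh (n : int) : uea L := uea_gen ((tmon sl2_h n, 0) : L).
Let gf (n : int) : uea L := uea_gen ((tmon sl2_f n, 0) : L).
Let uea_gen0 : uea_gen (0 : L) = 0.
Proof.
have := uea_gen_linear (-1) (0 : L) 0.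
by rewrite scaler0 addr0 scaleN1r addNr.
Qed.

Let gz : uea L := uea_gen ((0, 1) : L).

Lemma whittaker_cyclic (m : W) : exists r : uea L, m = r *: w.
Proof.
elim/tens_ind: m => [|_ _ [r ->] [r' ->]|r c].
- by exists 0; rewrite scale0r.
- by exists (r - r'); rewrite scalerBl.
exists (r * uea_map (eAK_hom B) (c%:A)); rewrite scale_tens mulr1.
rewrite tens_bal; congr tens; rewrite whit_scaleE.
have -> : uea_lift (whit_rep phi kdot) c%:A = c by rewrite linearZ rmorph1; apply: mulr1.
exact/esym/mulr1.
Qed.

Lemma lie_tmon x m y n : lie ((tmon x m, 0) : L) ((tmon y n, 0) : L) =
  (if m + n == 0 then m%:~R * B x y else 0) *: ((0, 1) : L) + (tmon (lie x y) (m + n), 0).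
Proof.
rewrite -[LHS]/(loop_lie (tmon x m) (tmon y n), loop_cocycle B (tmon x m) (tmon y n)).
rewrite loop_lie_tmon cocycle_tmon; set c := if _ then _ else _.
rewrite -[RHS]/(c *: 0 + tmon (lie x y) (m + n), c * 1 + 0).
by rewrite scaler0 add0r addr0 mulr1.
Qed.

Lemma gen_comm x m y n : uea_gen ((tmon x m, 0) : L) * uea_gen ((tmon y n, 0) : L) =
  uea_gen ((tmon y n, 0) : L) * uea_gen ((tmon x m, 0) : L)
  + uea_gen ((tmon (lie x y) (m + n), 0) : L)
  + (if m + n == 0 then m%:~R * B x y else 0) *: gz.
Proof.
apply/eqP; rewrite -addrA addrC -subr_eq -uea_gen_lie lie_tmon uea_gen_linear.
by rewrite [_ *: _ + _]addrC.
Qed.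

Lemma gen_scale c x n : uea_gen ((tmon (c *: x) n, 0) : L) = c *: uea_gen ((tmon x n, 0) : L).
Proof.
have -> : ((tmon (c *: x) n, 0) : L) = c *: ((tmon x n, 0) : L) + 0.
  by rewrite addr0 -[RHS]/(c *: tmon x n, c * 0) tmonZ mulr0.
by rewrite uea_gen_linear uea_gen0 addr0.
Qed.

Lemma gz_central u : gz * u = u * gz.
Proof.
elim/uea_gen_ind: u => [|c u v IHu IHv|x u IH]; first by rewrite mulr1 mul1r.
  by rewrite mulrDr mulrDl -scalerAr -scalerAl IHu IHv.
have gzx : gz * uea_gen x = uea_gen x * gz.
  apply/eqP; rewrite -subr_eq0 -uea_gen_lie; apply/eqP.
  have -> : lie ((0, 1) : L) x = 0.
    by rewrite -[LHS]/(loop_lie 0 x.1, loop_cocycle B 0 x.1) loop_lie0l cocycle0l.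
  exact: uea_gen0.
by rewrite mulrA gzx -mulrA IH mulrA.
Qed.

Let J (u : uea L) : Prop := u *: w = 0.

Lemma J_ideal : left_ideal J.
Proof. exact: annihilator_ideal. Qed.

Let eAK_e n : eAK_hom B (tmon (1 : k^o) n, 0) = (tmon sl2_e n, 0).
Proof.
rewrite -[LHS]/(e_tens (tmon (1 : k^o) n), 0); congr (_, _).
apply/malgP => m; rewrite e_tens_coef !mcoeffU.
by case: (n == m); rewrite ?scale1r ?scale0r.
Qed.

Let eAK_z : eAK_hom B (0, 1) = (0, 1).
Proof.
rewrite -[LHS]/(e_tens 0, 1); congr (_, _).
by apply/malgP => m; rewrite e_tens_coef !mcoeff0 scale0r.
Qed.

Lemma J_e n : J (ge n - (ph n)%:A).
Proof.
apply: annihilator_sub; have := whit_vecE B phi kdot (tmon (1 : k^o) n, 0).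
rewrite eAK_e (_ : whit_char _ _ _ = ph n) // /whit_char.
by rewrite -[LHS]/(ph n + kdot * 0) mulr0 addr0.
Qed.

Lemma J_z : J (gz - kdot%:A).
Proof.
apply: annihilator_sub; have := whit_vecE B phi kdot (0, 1).
rewrite eAK_z (_ : whit_char _ _ _ = kdot) // /whit_char.
by rewrite -[LHS]/(phi 0 + kdot * 1) linear0 add0r mulr1.
Qed.

Let c_ef (m n : int) : k := if m + n == 0 then m%:~R * b else 0.
Let c_hh (m n : int) : k := if m + n == 0 then m%:~R * B sl2_h sl2_h else 0.

Let gen_comm0 x m y n : B x y = 0 ->
  uea_gen ((tmon x m, 0) : L) * uea_gen ((tmon y n, 0) : L) =
  uea_gen ((tmon y n, 0) : L) * uea_gen ((tmon x m, 0) : L)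
  + uea_gen ((tmon (lie x y) (m + n), 0) : L).
Proof. by move=> Bxy; rewrite gen_comm Bxy mulr0 if_same scale0r addr0. Qed.

Let gen0 n : uea_gen ((tmon 0 n, 0) : L) = 0.
Proof. by rewrite -(scale0r sl2_e) gen_scale scale0r. Qed.

Let g_ef m n : ge m * gf n = gf n * ge m + gh (m + n) + c_ef m n *: gz.
Proof. by rewrite /ge /gf gen_comm lie_ef. Qed.
Let g_hh m n : gh m * gh n = gh n * gh m + c_hh m n *: gz.
Proof. by rewrite /gh gen_comm liexx gen0 addr0. Qed.
Let g_ff m n : gf m * gf n = gf n * gf m.
Proof. by rewrite /gf gen_comm0 ?form_ff // liexx gen0 addr0. Qed.
Let g_eh m n : ge m * gh n = gh n * ge m - 2 *: ge (m + n).
Proof.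
rewrite /ge /gh gen_comm0; last by rewrite inv_form_sym form_he.
by rewrite lieC lie_he -scaleNr gen_scale scaleNr.
Qed.
Let g_hf m n : gh m * gf n = gf n * gh m - 2 *: gf (m + n).
Proof. by rewrite /gh /gf gen_comm0 ?form_hf // lie_hf gen_scale scaleNr. Qed.

Lemma uea_spanned (u : uea L) : spanned gh gf J u.
Proof.
elim/uea_gen_ind: u => [|c u v Su Sv|x u Su].
- exact: (spanned1 gh gf J_ideal).
- exact: (spanned_lin J_ideal c Su Sv).
pose S x := spanned gh gf J (uea_gen x * u).
have Slin c (y y' : L) : S y -> S y' -> S (c *: y + y').
  rewrite /S uea_gen_linear mulrDl -scalerAl; exact: (spanned_lin J_ideal).
have S0 : S 0.
  rewrite /S uea_gen0 mul0r; apply: (spannedJ gh gf); exact: (lideal0 J_ideal).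
case: x => a r.
have -> : ((a, r) : L) = r *: ((0, 1) : L) + (a, 0).
  rewrite -[RHS]/(r *: 0 + a, r * 1 + 0).
  by rewrite scaler0 add0r mulr1 addr0.
apply: (Slin); first exact: (spanned_central gz_central J_ideal J_z Su).
elim/laurent_ind: a => [|a a' IH IH'|y n]; first exact: S0.
  have -> : ((a + a', 0) : L) = 1 *: ((a, 0) : L) + (a', 0).
    by rewrite -[RHS]/(1 *: a + a', 1 * 0 + 0) scale1r mulr0 addr0.
  exact: (Slin 1 (a, 0) (a', 0) IH IH').
elim/sl2_ind: y => [c y y' IH IH'|||].
- have -> : ((tmon (c *: y + y') n, 0) : L) = c *: ((tmon y n, 0) : L) + (tmon y' n, 0).
    by rewrite -[RHS]/(c *: tmon y n + tmon y' n, c * 0 + 0) mulr0 addr0 tmonD tmonZ.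
  exact: (Slin c (tmon y n, 0) (tmon y' n, 0) IH IH').
- exact: (spanned_e g_ef g_eh gz_central J_ideal J_e J_z n Su).
- exact: (spanned_gen J_ideal (true, n) Su).
- exact: (spanned_gen J_ideal (false, n) Su).
Qed.

(** By proper_ideal_min, no proper left ideal strictly contains the annihilator
   of w. *)
Lemma whittaker_irreducible (N : {pred W}) :
  (forall (s : seq int) (c : int -> k), uniq s ->
    (forall n, \sum_(m <- s) c m * ph (n + m) = 0) -> forall m, m \in s -> c m = 0) ->
  submod_closed N -> (forall m, m \in N -> m = 0) \/ (forall m, m \in N).
Proof.
move=> ph_nd; apply: (cyclic_irreducible whittaker_cyclic) => I idI JI I1 r Ir.
have [D Fr] := uea_spanned r.
exact: (proper_ideal_min g_ef g_eh g_hf g_hh g_ff gz_central J_ideal J_e J_z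
  ph_nd idI JI I1 Fr Ir).
Qed.
End Whit.

(** * Morphisms out of the Whittaker module *)

(** The universal property of the tensor product, as a way to detect nonzero
   tensors. *)
Lemma tens_eq0 (S R : nzRingType) (f : {rmorphism S -> R}) (M : lmodType S)
    (V : zmodType) (F : R -> M -> V) :
  (forall m, {morph F^~ m : r s / r + s}) -> (forall r, {morph F r : m n / m + n}) ->
  (forall r s m, F (r * f s) m = F r (s *: m)) ->
  forall r m, tens f r m = 0 -> F r m = 0.
Proof.
move=> FDl FDr Fbal r m; pose ev := msum (fun (p : R * M) (n : int) => F p.1 p.2 *~ n).
have evB : {morph ev : a b / a - b}.
  by apply: msumB => p x y; rewrite mulrzBr.
have evU r' m' : ev (ftens r' m') = F r' m'.
  by rewrite /ev msumU ?mulr1z // => p x y; rewrite mulrzBr.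
have evD : {morph ev : a b / a + b} by apply: morphB_D.
rewrite -(tens_pi0 f) => /tens_piP; rewrite subr0 => rm0; rewrite -evU; move: rm0.
apply: (subgroup_gen_min (H := fun a => ev a = 0)) => [|s].
  by split=> [|x y]; [apply: msum0 | rewrite evB => -> ->; rewrite subrr].
case=> [r1 r2 m1|r1 m1 m2|r1 s1 m1]; rewrite evB ?evD !evU.
- by rewrite FDl subrr.
- by rewrite FDr subrr.
- by rewrite Fbal subrr.
Qed.

Section WhittakerLift.
Variables (k : numFieldType) (B : inv_form (sl2 k)).
Variables (phi : {scalar (laurent k^o)}) (kdot : k).
Variables (V : lmodType k) (V0 : exists v : V, v != 0).
Variables (rho : lie_rep (affine B) (nzendo V0)) (v : V).
Hypothesis rho_whit : forall u : eAK k,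
  (rho (eAK_hom B u) : endo V) v = whit_char phi kdot u *: v.

Lemma lift_char s : (uea_lift rho (uea_map (eAK_hom B) s) : endo V) v =
  uea_lift (whit_rep phi kdot) s *: v.
Proof.
elim/uea_gen_ind: s => [|c s t IHs IHt|u s IH].
- by rewrite !rmorph1 nzendo1E scale1r.
- by rewrite !linearP nzendoLE IHs IHt scalerDl scalerA.
have mapM : uea_map (eAK_hom B) (uea_gen u * s) =
    uea_gen (eAK_hom B u) * uea_map (eAK_hom B) s.
  by rewrite rmorphM /= uea_map_gen.
have liftM : uea_lift rho (uea_gen (eAK_hom B u) * uea_map (eAK_hom B) s) =
    rho (eAK_hom B u) * uea_lift rho (uea_map (eAK_hom B) s).
  by rewrite rmorphM /= uea_lift_gen.
have lineM : uea_lift (whit_rep phi kdot) (uea_gen u * s) =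
    whit_char phi kdot u * uea_lift (whit_rep phi kdot) s.
  by rewrite rmorphM /= uea_lift_gen.
rewrite mapM liftM lineM nzendoME IH linearZ /= rho_whit scalerA.
by rewrite mulrC.
Qed.

(** The universal property: a vector on which the e t^n and the central element
   act as on the generator of W defines a module morphism from W. *)
Lemma whittaker_lift r : r *: whit_vec B phi kdot = 0 -> (uea_lift rho r : endo V) v = 0.
Proof.
pose F (u : uea (affine B)) (c : whit_line phi kdot) : V :=
  (uea_lift rho u : endo V) ((c : k) *: v).
rewrite /whit_vec scale_tens mulr1 => /(tens_eq0 (F := F)) F0.
rewrite -[v]scale1r; apply: F0 => [c a b|a c d|a s c]; rewrite /F.
- by rewrite raddfD -[_ + _]scale1r scale1r.
- by rewrite scalerDl raddfD.
rewrite rmorphM nzendoME; congr (endo_fun _ _).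
by rewrite linearZ /= lift_char whit_scaleE scalerA mulrC.
Qed.

Lemma lift_annihilator_ideal : left_ideal (fun r => (uea_lift rho r : endo V) v = 0).
Proof.
split=> [|r s r0 s0|a r r0]; first by rewrite rmorph0.
  by rewrite addrC -scaleN1r linearP nzendoLE r0 s0 scaler0 addr0.
by rewrite rmorphM nzendoME r0 raddf0.
Qed.
End WhittakerLift.

Section WhittakerGenerators.
Variables (k : numFieldType) (B : inv_form (sl2 k)).
Variables (phi : {scalar (laurent k^o)}) (kdot : k).
Variables (V : lmodType k) (V0 : exists v : V, v != 0).
Variables (rho : lie_rep (affine B) (nzendo V0)) (v : V).
Hypothesis rho_e : forall n,
  (rho (tmon sl2_e n, 0) : endo V) v = phi (tmon (1 : k^o) n) *: v.
Hypothesis rho_z : (rho (0, 1) : endo V) v = kdot *: v.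

Lemma rho_whit_char (u : eAK k) :
  (rho (eAK_hom B u) : endo V) v = whit_char phi kdot u *: v.
Proof.
have rhoL c (x y : affine B) :
    (rho (c *: x + y) : endo V) v = c *: (rho x : endo V) v + (rho y : endo V) v.
  by rewrite lie_rep_linear nzendoLE.
have rho0 : (rho 0 : endo V) v = 0.
  by have := rhoL (-1) 0 0; rewrite scaler0 addr0 scaleN1r addNr.
case: u => a r.
rewrite -[eAK_hom B _]/((e_tens a, r) : affine B).
rewrite -[whit_char _ _ _]/(phi a + kdot * r).
have -> : ((e_tens a, r) : affine B) = r *: ((0, 1) : affine B) + (e_tens a, 0).
  by rewrite -[RHS]/(r *: 0 + e_tens a, r * 1 + 0) scaler0 add0r mulr1 addr0.
rewrite rhoL rho_z scalerA addrC scalerDl [r * _]mulrC; congr (_ + _).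
elim/malg_ind: a => [|a a' IH IH'|n c].
- rewrite linear0 scale0r -[RHS]rho0; congr (endo_fun (rho _) v).
  by congr (_, _); apply/malgP => m; rewrite e_tens_coef !mcoeff0 scale0r.
- have -> : ((e_tens (a + a'), 0) : affine B) =
      1 *: ((e_tens a, 0) : affine B) + (e_tens a', 0).
    rewrite -[RHS]/(1 *: e_tens a + e_tens a', 1 * 0 + 0) -e_tens_linear.
    by rewrite scale1r mulr0 addr0.
  by rewrite rhoL IH IH' scale1r linearD scalerDl.
have -> : ((e_tens (tmon (c : k^o) n), 0) : affine B) =
    c *: ((tmon sl2_e n, 0) : affine B) + 0.
  rewrite addr0 -[RHS]/(c *: tmon sl2_e n, c * 0) mulr0; congr (_, _).
  apply/malgP => m; rewrite e_tens_coef laurent_coefZ !mcoeffU.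
  by case: (n == m); rewrite ?scaler0 ?scale0r.
rewrite rhoL rho0 rho_e addr0 scalerA; congr (_ *: _).
rewrite -[<< c *g n >>]/(tmon (c : k^o) n).
have -> : tmon (c : k^o) n = c *: tmon (1 : k^o) n by rewrite tmonZ -[c *: 1]/(c * 1) mulr1.
by rewrite linearZ.
Qed.
End WhittakerGenerators.

(** * Simplicity *)

(** The vectors r w with r in I form a submodule, which misses w when I is
   proper. *)
Lemma simple_maximal (R : nzRingType) (M : lmodType R) (w : M) (I : R -> Prop) :
  simple_module M -> left_ideal I -> (forall u, u *: w = 0 -> I u) -> ~ I 1 ->
  forall u, I u -> u *: w = 0.
Proof.
move=> [_ simM] idI wI I1 u Iu; have [I0 _ IM] := idI.
pose N : {pred M} := fun m => `[< exists2 r, I r & m = r *: w >].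
have NL : submod_closed N.
  split=> [|a m m' /asboolP[r Ir ->] /asboolP[r' Ir' ->]]; apply/asboolP.
    by exists 0; rewrite ?scale0r.
  exists (a * r + r'); last by rewrite scalerDl scalerA.
  by apply: (lidealD idI) => //; apply: IM.
have [N0|NT] := simM N NL; first by apply: N0; apply/asboolP; exists u.
have /asboolP[r Ir wr] := NT w; case: I1.
have I1r : I (1 - r) by apply: wI; rewrite scalerBl scale1r -wr subrr.
by rewrite -[1](subrK r); apply: (lidealD idI).
Qed.

Theorem whittaker_simpleP (k : numClosedFieldType) (B : inv_form (sl2 k))
    (phi : {scalar (laurent k^o)}) (kdot : k) :
  simple_module (whittaker B phi kdot) <-> ~ exp_polynomial phi.
Proof.
pose ph n := phi (tmon (1 : k^o) n).
pose rho := coind_rep B kdot ph; pose X := coind k (nat -> nat).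
pose v J a : X := whit_coind ph J a.
have lift J a r : r *: whit_vec B phi kdot = 0 -> (uea_lift rho r : endo X) (v J a) = 0.
  apply: whittaker_lift; apply: rho_whit_char; first by move=> n; apply: coind_rep_e.
  exact: coind_rep_central.
have lift1 J a : (uea_lift rho 1 : endo X) (v J a) <> 0.
  by rewrite rmorph1 nzendo1E; apply/eqP/whit_coind_neq0.
split=> [simW exp_phi|nexp].
  have [P P0 Pph] := @expseq_recurrence k ph exp_phi.
  (* only the coordinate that the leading term of P meets is nonzero, and it is
     scaled so that h (x) t^(- size P) P acts by c *)
  pose a (c : k) (j : nat) := (j == 1%N)%:R * (c / lead_coef P).
  pose y := uea_gen (affine_hP B P).
  have yv c : (uea_lift rho y : endo X) (v (size P).+1 (a c)) = c *: v (size P).+1 (a c).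
    rewrite /y uea_lift_gen coind_rep_hP //; congr (_ *: _).
    have lP : lead_coef P != 0 by rewrite lead_coef_eq0.
    have sP : (0 < size P)%N by rewrite size_poly_gt0.
    have sP1 : ((size P).-1 < size P)%N by rewrite prednK.
    rewrite (bigD1 (Ordinal sP1)) //= big1 ?addr0 => [|i ni].
      have -> : (size P - (size P).-1)%N = 1%N by lia.
      by rewrite /a eqxx mul1r mulrC divfK.
    have /negPf i1 : (size P - i)%N != 1%N.
      apply: contraNneq ni => si; apply/eqP/val_inj.
      by rewrite /= -subn1 -[X in (_ - X)%N]si subKn // ltnW.
    by rewrite /a i1 mul0r mulr0.
  have y0 : y *: whit_vec B phi kdot = 0.
    apply: (simple_maximal simW (lift_annihilator_ideal rho (v (size P).+1 (a 0)))).
    - exact: lift.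
    - exact: lift1.
    by rewrite yv scale0r.
  have := lift (size P).+1 (a 1) _ y0; rewrite yv scale1r.
  exact/eqP/whit_coind_neq0.
split.
  exists (whit_vec B phi kdot); apply/eqP => w0.
  by apply: (lift1 0%N (fun=> 0)); apply: lift; rewrite w0 scaler0.
move=> N; apply: whittaker_irreducible => s c us rec m ms.
apply/eqP; apply: contra_notT nexp => cm.
by apply: (recurrence_expseq us rec); exists m.
Qed.

Local Open Scope complex_scope.

Theorem proposition5p9 (R : realType) (B : inv_form (sl2 R[i]))
    (B_nondegenerate : nondegenerate_form B)
    (phi : {scalar (laurent (R[i])^o)}) (kdot : R[i]) :
  simple_module (whittaker B phi kdot) <-> ~ exp_polynomial phi.
Proof. exact: whittaker_simpleP. Qed.
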